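(* Let $X\subseteq\mathbb{R}^n$ be nonempty, closed and convex, let $Y\subseteq\mathbb{R}^m$ be closed, convex and unbounded, and let $O_X\supseteq X$ and $O_Y\supseteq Y$ be open sets. Let $g:\mathbb{R}^n\times\mathbb{R}^m\to\mathbb{R}$ be Lipschitz continuous and let $\{g_\mu:\mu>0\}$ be a family of smooth approximations of $g$ over $O_X\times O_Y$. Let $\{Y_\mu:\mu>0\}$ be a family of compact subsets of $Y$ with $\mathrm{vol}(Y_\mu)>0$ and $Y_\mu\nearrow Y$. Define, for $x\in O_X$, $y\in Y$, $\mu>0$, $$v(x)=\min_{y\in Y}g(x,y),\quad S(x)=\operatorname*{arg\,min}_{y\in Y}g(x,y),\quad v_\mu^{\rm ent}(x)=-\mu\ln\Big(\int_{Y_\mu}\exp(-\mu^{-1}g_\mu(x,y))\,dy\Big),$$ $$\alpha_\mu(x,y)=\frac{\exp(-\mu^{-1}g_\mu(x,y))}{\int_{Y_\mu}\exp(-\mu^{-1}g_\mu(x,z))\,dz}.$$ Let $\bar x\in O_X$ and suppose that: (1) $g$ is level-bounded in $y$ locally uniformly in $x$; (2) for every open set $\Omega'$ with $\mathrm{cl}(\Omega')\subseteq O_X$, $g_\mu\to g$ uniformly on $\mathrm{cl}(\Omega')\times Y$ as $\mu\searrow0$; (3) $\mathrm{dist}(\nabla_xg_\mu(x,\cdot),\partial_xg(x,\cdot))$ converges to $0$ uniformly on $Y$ as $(x,\mu)\to(\bar x,0)$ with $\mu>0$; (4) $\mu\ln\mathrm{vol}(Y_\mu)\to0$ as $\mu\searrow0$;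 (5) for any closed subset $Z$ of $Y\setminus S(\bar x)$ there exists an integrable function $h:Z\to\mathbb{R}$ such that $\alpha_\mu(x,y)\le h(y)$ for all $y\in Z$ and all $(x,\mu)$ (with $\mu>0$) in some neighborhood of $(\bar x,0)$; (6) for any closed subset $Z$ of $Y\setminus S(\bar x)$ there exists an integrable function $H:Z\to\mathbb{R}$ such that $\alpha_\mu(x,y)\|\nabla_xg_\mu(x,y)\|\le H(y)$ for all $y\in Z$ and all $(x,\mu)$ (with $\mu>0$) in some neighborhood of $(\bar x,0)$. Then the family of smooth approximations $\{v_\mu^{\rm ent}:\mu>0\}$ of $v$ satisfies the gradient consistent property at $\bar x$ under any one of the following conditions, where $\Omega$ is a neighborhood of $\bar x$: (a) $\nabla_xg(x,y)$ exists and is continuous on $\Omega\times O_Y$; or (b) there is $\rho>0$ such that $g(\cdot,y)$ is $\rho$-weakly concave on $\Omega$ for any $y\in Y$; or (c) $\partial g(\bar x,\bar y)=\partial_xg(\bar x,\bar y)\times\partial_yg(\bar x,\bar y)$ for all $\bar y\in S(\bar x)$, and $g$ is convex in $(x,y)$.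
   Context: $Y_\mu\nearrow Y$ means $Y_\mu\subseteq Y_{\mu'}\subseteq Y$ for all $0<\mu'<\mu$ and $\bigcup_{\mu>0}Y_\mu=Y$. Smooth approximations: for an open set $O\subseteq\mathbb{R}^d$ and a continuous function $\phi:O\to\mathbb{R}$, $\{\phi_\mu:\mu>0\}$ is a family of smooth approximations of $\phi$ over $O$ if each $\phi_\mu:O\to\mathbb{R}$ is continuously differentiable and for all $\bar z\in O$, $\lim_{z\to\bar z,\ \mu\searrow0}\phi_\mu(z)=\phi(\bar z)$. Such a family satisfies the gradient consistent property at $\bar z\in O$ if $\emptyset\neq\limsup_{z\to\bar z,\mu\searrow0}\nabla\phi_\mu(z)\subseteq\partial\phi(\bar z)$, where the limsup is the set of all $\xi\in\mathbb{R}^d$ for which there exist $z^k\to\bar z$ and $\mu_k\searrow0$ (with $\mu_k>0$) such that $\nabla\phi_{\mu_k}(z^k)\to\xi$. $\partial\phi$ is the Clarke generalized gradient: $\partial\phi(\bar z)=\{\xi:\phi^\circ(\bar z;d)\ge\langle\xi,d\rangle\ \forall d\}$ with $\phi^\circ(\bar z;d)=\limsup_{z\to\bar z,\,t\searrow0}\frac{\phi(z+td)-\phi(z)}{t}$. $\partial_xg(x,y)$ and $\partial_yg(x,y)$ are the Clarke generalized gradients of $g(\cdot,y)$ at $x$ and of $g(x,\cdot)$ at $y$. Level-boundedness: for each $x'\in\mathbb{R}^n$ and $M\in\mathbb{R}$ there is an open ball $B$ around $x'$ such that $\{(x,y):x\in B,\ g(x,y)\le M\}$ is bounded. $h$ is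 $\rho$-weakly concave on a convex set $\Omega$ if $-h+\frac{\rho}{2}\|\cdot\|^2$ is convex on $\Omega$ (so $\Omega$ is understood to be convex in case (b)). $\mathrm{dist}(z,A)=\min\{\|a-z\|:a\in A\}$; $\mathrm{vol}$ is Lebesgue measure; $\mathrm{cl}$ is closure. *)

(* Defs.v *)
From HB Require Import structures.
From mathcomp Require Import all_boot all_order all_algebra.
From mathcomp Require Import all_classical all_reals all_analysis.
From mathcomp Require Import measurable_realfun.

Set Implicit Arguments.
Unset Strict Implicit.
Unset Printing Implicit Defensive.

Import Order.TTheory GRing.Theory Num.Theory.
Import numFieldTopology.Exports numFieldNormedType.Exports.

Local Open Scope classical_set_scope.
Local Open Scope ring_scope.

(* 'rV[R]_n equipped with its Borel sigma-algebra. *)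
Notation borel_rV R n := (g_sigma_algebraType (open : set (set 'rV[R]_n))).

Section lebesgue_rV_step.
Variables (R : realType) (n : nat).

Definition cons_rV (p : measurableTypeR R * borel_rV R n) : borel_rV R n.+1 :=
  row_mx (const_mx p.1 : 'rV[R]_1) (p.2 : 'rV[R]_n) : 'rV[R]_(1 + n).

Definition uncons_rV (v : borel_rV R n.+1) : measurableTypeR R * borel_rV R n :=
  ((v : 'rV[R]_n.+1) 0 0, rsubmx (v : 'rV[R]_(1 + n))).

Lemma cons_rVK : cancel cons_rV uncons_rV.
Proof.
case=> x v; rewrite /uncons_rV /cons_rV row_mxKr/=; congr pair.
rewrite (_ : 0 = lshift n 0 :> 'I_(1 + n)); last exact/val_inj.
by rewrite (row_mxEl (const_mx x : 'rV[R]_1) (v : 'rV[R]_n)) mxE.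
Qed.

Lemma measurable_cons_rV : measurable_fun setT cons_rV.
Proof.
apply: (measurability ((open : set (set 'rV[R]_n.+1)) : set (set (borel_rV R n.+1)))) => [//|].
move=> _ [U oU <-]; rewrite setTI.
pose B (i : 'rV[rat]_n.+1 * rat) : set 'rV[R]_n.+1 :=
  ball (map_mx ratr i.1 : 'rV[R]_n.+1) (ratr i.2).
pose A i := if `[< B i `<=` U >] then B i else set0.
have -> : U = \bigcup_i A i.
  rewrite predeqE => v; split=> [Uv|[i _]]; last first.
    by rewrite /A; case: asboolP => // BU /BU.
  have /nbhs_ballP[e /= e0 eU] : nbhs v U by exact: open_nbhs_nbhs.
  have /rat_in_itvoo[r] : 0 < e / 2 by rewrite divr_gt0.
  rewrite inE/= => /andP[r0 re]; rewrite !bnd_simp in r0 re.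
  have Q j : {q : rat | `|v 0 j - ratr q| < ratr r}.
    apply: cid; have /rat_in_itvoo[q] : v 0 j - ratr r < v 0 j + ratr r.
      by rewrite ltrD2l gtrN.
    rewrite inE => /andP[h1 h2]; rewrite !bnd_simp in h1 h2; exists q.
    by rewrite ltr_distlC h1 h2.
  pose w := \row_j sval (Q j).
  have wv : B (w, r) v.
    split=> // i j; rewrite !mxE ord1 /ball/= distrC.
    by case: (Q j).
  exists (w, r) => //; rewrite /A; case: asboolP => // -[] u wu.
  have wle := @le_ball _ _ (map_mx ratr w : 'rV[R]_n.+1) _ _ (ltW re).
  exact/eU/(ball_splitr (wle _ wv))/(wle _ wu).
rewrite preimage_bigcup; apply: countable_bigcupT_measurable => // -[q r].
rewrite /A; case: asboolP => _; last by rewrite preimage_set0.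
have -> : cons_rV @^-1` B (q, r) =
    (ball (ratr (q 0 0) : R) (ratr r) : set (measurableTypeR R)) `*`
    (ball (rsubmx (map_mx ratr q : 'rV[R]_(1 + n)))  (ratr r)
     : set (borel_rV R n)).
  have c0 x v : cons_rV (x, v) 0 0 = x.
    by have [] := cons_rVK (x, v).
  have cS x (v : 'rV[R]_n) j : cons_rV (x, v) 0 (lift 0 j) = v 0 j.
    have [_] := cons_rVK (x, v); rewrite /uncons_rV/= => {2}<-.
    by rewrite [RHS]mxE (_ : lift 0 j = rshift 1 j)//; exact/val_inj.
  rewrite predeqE => -[x v]; split => [[r0 qr]|[qx [r0 qv]]].
    split; first by have := qr 0 0; rewrite c0 mxE.
    split=> // i j; rewrite ord1.
    have := qr 0 (lift 0 j); rewrite cS !mxE.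
    by rewrite (_ : rshift 1 j = lift 0 j)//; exact/val_inj.
  split=> // i j; rewrite ord1; case: (unliftP 0 j) => [k|] ->.
    rewrite cS; have := qv 0 k; rewrite !mxE.
    by rewrite (_ : rshift 1 k = lift 0 k)//; exact/val_inj.
  by rewrite c0 mxE.
apply: measurableX; first by rewrite ball_itv; exact: measurable_itv.
apply: sub_sigma_algebra; exact: ball_open.
Qed.


Lemma measurable_uncons_rV : measurable_fun setT uncons_rV.
Proof.
apply: measurable_fun_pair.
  apply: (measurability _ (RGenOpens.measurableE R)).
  move=> _ [_ [a [b ->] <-]]; rewrite setTI; apply: sub_sigma_algebra.
  have /continuousP := @coord_continuous R 1 n.+1 0 0; apply.
  exact: interval_open.
apply: (measurability ((open : set (set 'rV[R]_n)) : set (set (borel_rV R n)))) => [//|].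
move=> _ [U oU <-]; rewrite setTI; apply: sub_sigma_algebra.
suff /continuousP : continuous (rsubmx : 'rV[R]_(1 + n) -> 'rV[R]_n) by exact.
move=> v A /nbhs_ballP[e e0 eA]; apply/nbhs_ballP; exists e => // u [_ vu].
by apply: eA; split=> // i j; rewrite !mxE; exact: vu.
Qed.

Variable mu : {sigma_finite_measure set (borel_rV R n) -> \bar R}.

Definition lebesgue_rVS : set (borel_rV R n.+1) -> \bar R :=
  pushforward (lebesgue_measure \x mu)%E cons_rV.

Let product : {measure set (measurableTypeR R * borel_rV R n) -> \bar R} :=
  (lebesgue_measure \x mu)%E.

HB.instance Definition _ := Measure.copy lebesgue_rVS
  (measure_function_pushforward__canonical__measure_function_Measure
    product measurable_cons_rV).

Let lebesgue_rVS_sigma_finite : sigma_finite setT lebesgue_rVS.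
Proof.
have /sigma_finiteP[F [TF ndF Foo]] := sigma_finiteT (@lebesgue_measure R).
have /sigma_finiteP[G [TG ndG Goo]] := sigma_finiteT mu.
exists (fun k => uncons_rV @^-1` (F k `*` G k)).
  rewrite -preimage_bigcup (_ : \bigcup_k _ = setT) ?preimage_setT//.
  rewrite -subTset -setXTT TF TG => -[x v] [/= [i _ Fx] [j _ Gv]].
  exists (maxn i j) => //; split.
    by move: x Fx; exact/subsetPset/ndF/leq_maxl.
  by move: v Gv; exact/subsetPset/ndG/leq_maxr.
move=> k; have [mF Fk] := Foo k; have [mG Gk] := Goo k.
have mFG : measurable (F k `*` G k) by exact: measurableX.
split; first by rewrite -[X in measurable X]setTI; exact: measurable_uncons_rV.
rewrite /lebesgue_rVS /pushforward -comp_preimage (_ : uncons_rV \o _ = id).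
  by rewrite preimage_id product_measure1E// lte_mul_pinfty// ge0_fin_numE.
exact/funext/cons_rVK.
Qed.

HB.instance Definition _ := Measure_isSigmaFinite.Build _ _ _ lebesgue_rVS
  lebesgue_rVS_sigma_finite.

End lebesgue_rV_step.

(* n-dimensional Lebesgue measure, as the iterated product of
   one-dimensional ones transported along (x, v) |-> row_mx x v. *)
Fixpoint lebesgue_rV (R : realType) (n : nat) :
    {sigma_finite_measure set (borel_rV R n) -> \bar R} :=
  match n with
  | 0 => \d_((0 : 'rV[R]_0) : borel_rV R 0)
  | n'.+1 => lebesgue_rVS (lebesgue_rV R n')
  end.

Lemma lebesgue_rV_box (R : realType) n (a b : 'rV[R]_n) : (forall i, a 0 i <= b 0 i) ->
  lebesgue_rV R n [set v | forall i, a 0 i <= v 0 i <= b 0 i] =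
  (\prod_i (b 0 i - a 0 i))%:E.
Proof.
elim: n a b => [|n IH] a b ab.
  rewrite big_ord0 /= diracE mem_set//. by case.
pose a' := rsubmx (a : 'rV[R]_(1+n)).
pose b' := rsubmx (b : 'rV[R]_(1+n)).
have l j : lift 0 j = rshift 1 j :> 'I_(1+n) by exact/val_inj.
rewrite big_ord_recl EFinM.
have -> : \prod_(i < n) (b 0 (lift ord0 i) - a 0 (lift ord0 i)) =
    \prod_i (b' 0 i - a' 0 i).
  by apply: eq_bigr => i _; rewrite /a' /b' !mxE !l.
rewrite -IH; last by move=> i; rewrite !mxE -l; exact: ab.
rewrite /=/lebesgue_rVS /pushforward.
have -> : (@cons_rV R n) @^-1` [set v | forall i, a 0 i <= v 0 i <= b 0 i] =
  (`[a 0 0, b 0 0]%classic : set (measurableTypeR R)) `*`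
  ([set v | forall i, a' 0 i <= v 0 i <= b' 0 i] : set (borel_rV R n)).
  have cS p j : cons_rV p 0 (lift 0 j) = p.2 0 j.
    rewrite -{2}(cons_rVK p) [RHS]mxE (_ : lift 0 j = rshift 1 j)//; exact/val_inj.
  have c0 p : cons_rV p 0 0 = p.1 by rewrite -{2}(cons_rVK p).
  rewrite predeqE => p; split => [H|[H1 H2] i].
    split; first by rewrite /= in_itv/= -c0; exact: H.
    by move=> i; rewrite -cS /a' /b' [a' 0 i]mxE [b' 0 i]mxE -!l; exact: H.
  case: (unliftP 0 i) => [k|] ->.
    by rewrite cS; have := H2 k; rewrite [a' 0 k]mxE [b' 0 k]mxE -!l.
  by rewrite c0; move: H1; rewrite /= in_itv.
rewrite product_measure1E//.
  congr (_ * _)%E; rewrite [LHS]lebesgue_measure_itv.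
  by rewrite /= lte_fin; case: ltgtP (ab 0) => // ->; rewrite subrr.
pose B i := (fun v : 'rV[R]_n => v 0 i) @^-1` `[a' 0 i, b' 0 i].
have -> : (fun v : borel_rV R n =>
    forall i, a' 0 i <= (v : 'rV[R]_n) 0 i <= b' 0 i) = \bigcap_i B i.
  rewrite predeqE => v; split => [H i _|H i]; last first.
    by have := H i I; rewrite /B/= in_itv.
  by rewrite /B/= in_itv/=; exact: H.
rewrite -[X in measurable X]setCK; apply: measurableC; apply: sub_sigma_algebra.
apply: (@closed_openC 'rV[R]_n); apply: closed_bigI => i _.
apply: preimage_closed; last exact: interval_closed.
by move=> v _; exact: coord_continuous.
Qed.

Section clarke_calculus.
Variables (R : realType) (d : nat).
Implicit Types (phi : 'rV[R]_d -> R).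
Implicit Types (u v z xi zbar : 'rV[R]_d) (O : set 'rV[R]_d).

Definition dotv u v : R := \sum_i u 0 i * v 0 i.

(* Euclidean norm; the library norm on 'rV[R]_d is the sup norm. *)
Definition enorm u : R := Num.sqrt (dotv u u).

(* The minimum is attained whenever A is nonempty and closed. *)
Definition dist z (A : set 'rV[R]_d) : R := inf [set enorm (a - z) | a in A].

Definition grad phi z : 'rV[R]_d :=
  \row_i 'D_(delta_mx 0 i : 'rV[R]_d) phi z.

Definition continuously_differentiable O phi : Prop :=
  (forall z, O z -> differentiable phi z) /\
  (forall z, O z -> {for z, continuous (grad phi)}).

Definition clarke_dd phi z v : \bar R :=
  limf_esup (fun p : 'rV[R]_d * R => ((phi (p.1 + p.2 *: v) - phi p.1) / p.2)%:E)
    (filter_prod (nbhs z) 0^'+).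

Definition clarke phi z : set 'rV[R]_d :=
  [set xi | forall v, ((dotv xi v)%:E <= clarke_dd phi z v)%E].

Definition weakly_concave (rho : R) (Omega : set 'rV[R]_d) phi : Prop :=
  convex_set (Omega : set (convex_lmodType 'rV[R]_d)) /\
  convex_function (Omega : set (convex_lmodType 'rV[R]_d))
    (fun z => - phi z + rho / 2 * enorm z ^+ 2).

(* Functions defined on O only are represented by total functions whose
   values outside O are irrelevant (O being open); similarly for the index
   mu, which matters only when positive. *)
Definition smooth_approximations (phi_ : R -> 'rV[R]_d -> R) phi O : Prop :=
  [/\ open O,
      forall z, O z -> {for z, continuous phi},
      forall mu, 0 < mu -> continuously_differentiable O (phi_ mu) &
      forall zbar, O zbar ->
        phi_ p.2 p.1 @[p --> filter_prod (nbhs zbar) 0^'+] --> phi zbar].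

Definition limsup_grad (phi_ : R -> 'rV[R]_d -> R) zbar : set 'rV[R]_d :=
  [set xi | exists (z_ : nat -> 'rV[R]_d) (mu_ : nat -> R),
    [/\ z_ k @[k --> \oo] --> zbar,
        forall k, 0 < mu_ k,
        mu_ k @[k --> \oo] --> (0 : R) &
        grad (phi_ (mu_ k)) (z_ k) @[k --> \oo] --> xi]].

Definition gradient_consistent (phi_ : R -> 'rV[R]_d -> R) phi zbar : Prop :=
  limsup_grad phi_ zbar !=set0 /\ limsup_grad phi_ zbar `<=` clarke phi zbar.

End clarke_calculus.

(* A point (x, y) of R^n * R^m is the concatenation row_mx x y. *)
Definition setX_rV (R : realType) (n m : nat)
    (A : set 'rV[R]_n) (B : set 'rV[R]_m) : set 'rV[R]_(n + m) :=
  [set z | A (lsubmx z) /\ B (rsubmx z)].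

Definition level_bounded (R : realType) (n m : nat)
    (g : 'rV[R]_(n + m) -> R) : Prop :=
  forall (x' : 'rV[R]_n) (M : R), exists2 r : R, 0 < r &
    bounded_set [set z | enorm (lsubmx z - x') < r /\ g z <= M].

Section minimization.
Variables (R : realType) (n m : nat).
Implicit Types (g : 'rV[R]_(n + m) -> R).
Implicit Types (Y : set 'rV[R]_m).
Implicit Types (x : 'rV[R]_n) (y : 'rV[R]_m) (mu : R).

Definition gradx g x y : 'rV[R]_n := grad (fun x' => g (row_mx x' y)) x.

Definition clarkex g x y : set 'rV[R]_n := clarke (fun x' => g (row_mx x' y)) x.

Definition clarkey g x y : set 'rV[R]_m := clarke (fun y' => g (row_mx x y')) y.

Definition vol (A : set 'rV[R]_m) : \bar R := lebesgue_rV R m A.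

(* The minimum is attained when g is continuous and level-bounded in y. *)
Definition value g Y x : R := inf [set g (row_mx x y) | y in Y].

Definition argmin g Y x : set 'rV[R]_m :=
  [set y | Y y /\ forall y', Y y' -> g (row_mx x y) <= g (row_mx x y')].

Definition gibbs_mass (g_ : R -> 'rV[R]_(n + m) -> R)
    (Y_ : R -> set 'rV[R]_m) mu x : R :=
  \int[lebesgue_rV R m]_(y in Y_ mu) expR (- mu^-1 * g_ mu (row_mx x y)).

Definition v_ent (g_ : R -> 'rV[R]_(n + m) -> R)
    (Y_ : R -> set 'rV[R]_m) mu x : R := - mu * ln (gibbs_mass g_ Y_ mu x).

Definition alpha (g_ : R -> 'rV[R]_(n + m) -> R)
    (Y_ : R -> set 'rV[R]_m) mu x y : R :=
  expR (- mu^-1 * g_ mu (row_mx x y)) / gibbs_mass g_ Y_ mu x.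

Definition increases_to (Y_ : R -> set 'rV[R]_m) Y : Prop :=
  (forall mu mu', 0 < mu' -> mu' < mu -> Y_ mu `<=` Y_ mu' /\ Y_ mu' `<=` Y) /\
  \bigcup_(mu in [set mu | 0 < mu]) Y_ mu = Y.

End minimization.

(* Main.v *)
(* Differentiating under the integral, the gradient of v_mu is the average of
   grad_x g_mu(x, .) for the Gibbs density alpha_mu = exp ((v_mu - g_mu) / mu).
   Where g(xbar, .) exceeds its minimum by delta, alpha_mu is at most a constant
   whose product with vol (Y_mu) is O(mu), by condition (4): the average
   concentrates on the minimizers.  Hence, by condition (3), <xi, d> <= c for every
   limit xi of gradients as soon as the partial difference quotients of g in
   direction d are at most c + e near (xbar, ybar), for each minimizer ybar and
   each e > 0.

   It remains to check this when c exceeds the Clarke derivative v'(xbar; d).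
   In case (a) by the mean value theorem, and in case (b) by concavity, these
   quotients are, up to e, at most a backward quotient of g(., ybar) at xbar,
   which is at most that of v because v <= g(., ybar) with equality at xbar.  In
   case (c) Hahn-Banach yields xi' in the partial subdifferential in x with
   <xi', d> equal to the partial Clarke derivative, and eta in the partial
   subdifferential in y that is nonnegative on Y - ybar; the product rule makes
   (xi', eta) a subgradient of g, so that xi' is a subgradient of v at xbar. *)

From HB Require Import structures.
Require Import Defs.
From mathcomp Require Import all_boot all_order all_algebra.
From mathcomp Require Import all_classical all_reals all_analysis.
From mathcomp Require Import measurable_realfun.
From mathcomp Require Import ring lra.

Set Implicit Arguments.
Unset Strict Implicit.
Unset Printing Implicit Defensive.

Import Order.TTheory GRing.Theory Num.Theory.
Import numFieldTopology.Exports numFieldNormedType.Exports.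

Local Open Scope classical_set_scope.
Local Open Scope ring_scope.

(** * Lebesgue measure on row vectors *)

(** Two obstacles shape the estimates. The bound on difference quotients is local around each
    minimizer, while [Y] is unbounded: level-boundedness makes the set of [y] in [Y] with
    [g(xbar, y) <= v(xbar) + 1] compact, and a covering argument there yields one gap [delta] valid
    for all of [Y]. Away from the minimizers the density is controlled through its exponent, which
    requires [v_mu] to converge to [v] jointly in [x] and [mu]. The upper half of that convergence
    needs the points of [Y_mu] close to a near-minimizer to keep a volume bounded below. Since
    [Y_mu] increases as [mu] decreases, one fixed piece of positive volume is enough. It exists
    because every ball centred in [Y] meets [Y] in positive measure: convexity places there a
    shrunken copy of [Y_1], so affine preimages of null sets have to be shown null. Only upper
    bounds on [<grad v_mu, d>] are ever proved. Lower bounds are the same statement for [-d], and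
    membership in a Clarke gradient is itself a family of upper bounds, one for each direction. *)

Section lebesgue_rV_theory.
Variable R : realType.

(** Uniqueness of Lebesgue measure: [a] times its pushforward under [x |-> a * x + b] has the right
    value on bounded half-open intervals, hence equals it. *)
Lemma lebesgue_measure_affine_null (a b : R) (A : set (measurableTypeR R)) :
  0 < a -> measurable A -> lebesgue_measure A = 0%E ->
  lebesgue_measure ((fun x : R => a * x + b) @^-1` A) = 0%E.
Proof.
move=> a0 mA A0.
pose f : measurableTypeR R -> measurableTypeR R := fun x : R => a * x + b.
have mf : measurable_fun setT f.
  by apply: measurable_funD => //; exact: measurable_funM.
pose nu : {measure set (measurableTypeR R) -> \bar R} :=
  (measure_function_pushforward__canonical__measure_function_Measure
     (@lebesgue_measure R) mf).
have E : forall B, measurable B ->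
    lebesgue_measure B = mscale (NngNum (ltW a0)) nu B.
  apply: lebesgue_measure_unique => /= _ [[u v] _ <-].
  rewrite /mscale /= /nu /= /pushforward.
  have -> : f @^-1` `]u, v]%classic = `](u - b) / a, (v - b) / a]%classic.
    rewrite predeqE => x; rewrite /f /= !in_itv/=.
    by rewrite ltr_pdivrMr// ler_pdivlMr// ltrBlDr lerBrDr ![x * a]mulrC.
  rewrite !lebesgue_measure_itv/= !lte_fin ltr_pM2r ?invr_gt0// ltrD2r.
  case: ifPn => _; last by rewrite mule0.
  by rewrite -!EFinB -EFinM; congr (_%:E); field; rewrite gt_eqF.
have := E _ mA; rewrite A0 /mscale /nu /= /pushforward => /esym/eqP.
rewrite mule_eq0 eqe gt_eqF//= => /eqP; exact.
Qed.

Lemma continuous_measurable_rV n k (f : 'rV[R]_n -> 'rV[R]_k) :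
  continuous f ->
  measurable_fun setT (f : borel_rV R n -> borel_rV R k).
Proof.
move=> /continuousP cf.
apply: (measurability ((open : set (set 'rV[R]_k)) : set (set (borel_rV R k)))) =>
  [//|].
by move=> _ [U oU <-]; rewrite setTI; apply: sub_sigma_algebra; exact: cf.
Qed.

Lemma continuous_affine n (a : R) (b : 'rV[R]_n) :
  continuous (fun u : 'rV[R]_n => a *: u + b).
Proof. move=> u; exact: (cvgD (@scaler_continuous _ _ a u) (cvg_cst b)).
Qed.

Lemma cons_rV_ord0 n (p : measurableTypeR R * borel_rV R n) : cons_rV p 0 0 = p.1.
Proof. by rewrite -{2}(cons_rVK p). Qed.

Lemma cons_rV_lift n (p : measurableTypeR R * borel_rV R n) j :
  cons_rV p 0 (lift 0 j) = (p.2 : 'rV[R]_n) 0 j.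
Proof.
rewrite -{2}(cons_rVK p) [RHS]mxE (_ : lift 0 j = rshift 1 j)//; exact/val_inj.
Qed.

(** Induction on the dimension through sections: a measurable set is null iff almost all of its
    sections are. Tracking null sets only avoids computing the factor [a ^ n]. *)
Lemma lebesgue_rV_affine_null n (a : R) (b : 'rV[R]_n) (N : set (borel_rV R n)) :
  0 < a -> measurable N -> lebesgue_rV R n N = 0%E ->
  lebesgue_rV R n ((fun u : 'rV[R]_n => a *: u + b) @^-1` N) = 0%E.
Proof.
move=> a0; elim: n b N => [|n IH] b N mN N0.
  by rewrite [X in lebesgue_rV R 0 X](_ : _ = N)// predeqE => u;
    rewrite /= (_ : a *: u + b = u)//; apply/rowP => -[].
pose f (u : 'rV[R]_n.+1) := a *: u + b.
have mfN : measurable (f @^-1` N : set (borel_rV R n.+1)).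
  rewrite -[X in measurable X]setTI.
  exact: (@continuous_measurable_rV _ _ f (@continuous_affine _ a b)).
have mcons (A : set (borel_rV R n.+1)) : measurable A ->
    measurable (@cons_rV R n @^-1` A).
  by move=> mA; rewrite -[X in measurable X]setTI; exact: measurable_cons_rV.
have volE A : lebesgue_rV R n.+1 A =
  (\int[lebesgue_measure]_x (lebesgue_rV R n \o xsection (@cons_rV R n @^-1` A)) x)%E
    by [].
have msec A : measurable A -> measurable [set x : measurableTypeR R |
       lebesgue_rV R n (xsection (@cons_rV R n @^-1` A) x) != 0%E].
  move=> mA; set phi := fun x => lebesgue_rV R n (xsection (@cons_rV R n @^-1` A) x).
  have mphi : measurable_fun setT phi.
    by apply: measurable_fun_xsection; exact: mcons.
  rewrite (_ : [set x | _] = phi @^-1` (~` [set 0%E])).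
    by rewrite -[X in measurable X]setTI; apply: mphi => //; exact: measurableC.
  by rewrite predeqE => x/=; split => /eqP.
(* The measure of [A] is the integral of the nonnegative function sending a first coordinate to the
   measure of its section, so it vanishes iff that function vanishes almost everywhere. *)
have null_sections A : measurable A -> lebesgue_rV R n.+1 A = 0%E <->
    lebesgue_measure [set x : measurableTypeR R |
       lebesgue_rV R n (xsection (@cons_rV R n @^-1` A) x) != 0%E] = 0%E.
  move=> mA; pose phi x := lebesgue_rV R n (xsection (@cons_rV R n @^-1` A) x).
  have mphi : measurable_fun setT phi.
    by apply: measurable_fun_xsection; exact: mcons.
  have mphi0 : measurable [set x | phi x != 0%E] := msec _ mA.
  have := ae_eq_integral_abs (@lebesgue_measure R) measurableT mphi.
  under eq_integral do rewrite gee0_abs//.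
  rewrite -volE => ->; split.
    move=> /= [B [mB B0 sB]]; apply/(measure_negligible mphi0).
    exists B; split=> // x /= phx; apply: sB => /=; apply/existsNP; exists I; exact/eqP.
  move=> phi0; exists [set x | phi x != 0%E]; split => // x /=.
  by move=> /not_implyP[_ /eqP].
apply/(null_sections _ mfN).
pose b1 := (b : 'rV[R]_n.+1) 0 0.
pose b2 := rsubmx (b : 'rV[R]_(1 + n)).
have fcons x (v : 'rV[R]_n) : f (cons_rV (x, v)) = cons_rV (a * x + b1, a *: v + b2).
  apply/rowP => i; rewrite [LHS]mxE [X in X + _]mxE; case: (unliftP 0 i) => [k|] ->.
    by rewrite !cons_rV_lift [RHS]mxE [X in _ = X + _]mxE [in RHS]mxE (_ :
      lift 0 k = rshift 1 k)//; exact/val_inj.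
  by rewrite !cons_rV_ord0.
have /(null_sections _ mN) /(lebesgue_measure_affine_null b1 a0 (msec _ mN)) E0 := N0.
(* By the induction hypothesis, a null section of [N] over [a * x + b1] gives a null section of the
   preimage over [x]. So the exceptional first coordinates of the preimage lie in the affine
   preimage of those of [N]. *)
apply/eqP; rewrite -measure_le0 -[leRHS]E0; apply: le_measure.
- by rewrite inE; exact: msec.
- rewrite inE -[X in measurable X]setTI.
  by apply: (measurable_funD _ _ _ (msec _ mN)) => //; exact: measurable_funM.
- move=> x /=; apply: contra => /eqP H.
  have mS : measurable (xsection (@cons_rV R n @^-1` N) (a * x + b1)).
    by apply: measurable_xsection; exact: mcons.
  rewrite -[X in X == _]/(lebesgue_rV R n _) [X in lebesgue_rV R n X](_ : _ = (fun v :
    'rV[R]_n => a *: v + b2) @^-1`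
      xsection (@cons_rV R n @^-1` N) (a * x + b1)); first by rewrite IH.
  by rewrite /xsection predeqE => v /=; rewrite !inE /= fcons.
Qed.

End lebesgue_rV_theory.

(** * Sup norm of row vectors and blocks; convexity along segments *)

Section rV_norm.
Variable R : realType.

Lemma rV_coord_le n (u : 'rV[R]_n) i : `|u 0 i| <= `|u|.
Proof.
rewrite [leRHS](_ : _ = mx_norm u)// mx_normrE; apply/bigmax_geP; right => /=.
by exists (0, i).
Qed.

Lemma rV_norm_le n (u : 'rV[R]_n) (c : R) :
  0 <= c -> (forall i, `|u 0 i| <= c) -> `|u| <= c.
Proof.
move=> c0 H; rewrite [leLHS](_ : _ = mx_norm u)// mx_normrE; apply/bigmax_leP;
  split=> //.
by move=> -[i j] _ /=; rewrite ord1.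
Qed.

Lemma norm_row_mx n m (x : 'rV[R]_n) (y : 'rV[R]_m) :
  `|row_mx x y| <= `|x| + `|y|.
Proof.
apply: rV_norm_le => [|i]; first by rewrite addr_ge0.
rewrite -(splitK i); case: (fintype.split i) => j /=.
  by rewrite row_mxEl (le_trans (rV_coord_le _ _))// lerDl.
by rewrite row_mxEr (le_trans (rV_coord_le _ _))// lerDr.
Qed.

Lemma norm_row_mxl n m (x : 'rV[R]_n) (y : 'rV[R]_m) : `|x| <= `|row_mx x y|.
Proof.
apply: rV_norm_le => // i.
by rewrite -(row_mxEl x y); exact: rV_coord_le.
Qed.

Lemma norm_row_mxr n m (x : 'rV[R]_n) (y : 'rV[R]_m) : `|y| <= `|row_mx x y|.
Proof.
apply: rV_norm_le => // i.
by rewrite -(row_mxEr x y); exact: rV_coord_le.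
Qed.

Lemma convex_setE (V : lmodType R) (A : set V) (x y : V) (a : R) :
  convex_set (A : set (convex_lmodType V)) -> A x -> A y -> 0 <= a -> a <= 1 ->
  A (a *: x + (1 - a) *: y).
Proof.
move=> cA Ax Ay a0 a1; apply/set_mem.
exact: (cA x y (Itv01 a0 a1) (mem_set Ax) (mem_set Ay)).
Qed.

Lemma convex_functionE (V : lmodType R) (A : set V) (f : V -> R) (x y : V) (a : R) :
  convex_function (A : set (convex_lmodType V)) f -> A x -> A y ->
  0 <= a -> a <= 1 ->
  f (a *: x + (1 - a) *: y) <= a * f x + (1 - a) * f y.
Proof.
move=> cf Ax Ay a0 a1.
exact: (cf (Itv01 a0 a1) x y (mem_set Ax) (mem_set Ay)).
Qed.

End rV_norm.

(** * Measure and integration over compact sets of row vectors *)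

Section lebesgue_rV_compact.
Variables (R : realType) (n : nat).
Implicit Types (A K U : set 'rV[R]_n).

Lemma open_measurable_rV A : open A -> measurable (A : set (borel_rV R n)).
Proof. by move=> oA; exact: sub_sigma_algebra. Qed.

Lemma closed_measurable_rV A : closed A -> measurable (A : set (borel_rV R n)).
Proof.
move=> cA; rewrite -[X in measurable X]setCK; apply: measurableC.
by apply: open_measurable_rV; rewrite openC.
Qed.

Lemma compact_measurable_rV K : compact K -> measurable (K : set (borel_rV R n)).
Proof.
by move=> cK; apply: closed_measurable_rV; apply: compact_closed => //;
  exact: norm_hausdorff.
Qed.

Lemma compact_finite_lebesgue_rV K : compact K -> (lebesgue_rV R n K < +oo)%E.
Proof.
move=> cK; have mK := compact_measurable_rV cK.
have [M [_ HM]] := compact_bounded cK.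
pose c : R := `|M| + 1.
have Mc : M < c by rewrite /c ltr_pwDr// ler_norm.
pose B : set 'rV[R]_n := [set v | forall i, (const_mx (- c) :
  'rV[R]_n) 0 i <= v 0 i <= (const_mx c : 'rV[R]_n) 0 i].
have KB : K `<=` B.
  move=> v Kv i; rewrite !mxE -ler_norml.
  by rewrite (le_trans (rV_coord_le _ _))//; apply: (HM _ Mc).
have mB : measurable (B : set (borel_rV R n)).
  apply: closed_measurable_rV.
  rewrite (_ : B = \bigcap_i ((fun v : 'rV[R]_n => v 0 i) @^-1` `[- c, c])).
    apply: closed_bigI => i _; apply: preimage_closed; last exact: interval_closed.
    by move=> v _; exact: coord_continuous.
  rewrite predeqE => v; split => [H i _|H i].
    by rewrite /= in_itv/=; have := H i; rewrite !mxE.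
  by have := H i I; rewrite /= in_itv/= !mxE.
apply: (@le_lt_trans _ _ (lebesgue_rV R n B)).
  by apply: le_measure; rewrite ?inE.
rewrite lebesgue_rV_box ?ltry// => i; rewrite !mxE.
by rewrite /c (@le_trans _ _ 0)// ?oppr_le0 addr_ge0.
Qed.

Lemma continuous_measurable_fun_rV U (f : 'rV[R]_n -> R) : open U ->
  {in U, continuous f} -> measurable_fun (U : set (borel_rV R n)) f.
Proof.
move=> oU cf; apply: (measurability _ (RGenOpens.measurableE R)).
move=> _ [_ [a [b ->] <-]].
apply: open_measurable_rV.
rewrite openE => x [Ux fx]; apply: filterI; first exact: open_nbhs_nbhs.
apply: (cf x (mem_set Ux)).
exact: open_nbhs_nbhs (conj (@interval_open _ _ _ _ _) fx).
Qed.

Lemma continuous_integrable_rV U K (f : 'rV[R]_n -> R) : open U -> K `<=` U ->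
  compact K -> {in U, continuous f} ->
  (lebesgue_rV R n).-integrable K (EFin \o f).
Proof.
move=> oU KU cK cf; have mK := compact_measurable_rV cK.
apply: measurable_bounded_integrable => //.
- exact: compact_finite_lebesgue_rV.
- apply: (measurable_funS (open_measurable_rV oU) KU).
  exact: continuous_measurable_fun_rV.
- have cfK : {within K, continuous f}.
    apply: continuous_in_subspaceT => x /set_mem Kx.
    by apply: cf; exact/mem_set/KU.
  have /compact_bounded[M [_ HM]] := continuous_compact cfK cK.
  by exists M; split; rewrite ?num_real // => ? ? ? ?; exact: HM.
Qed.

(* A homothetic copy of A centred at y lies in Y and in the ball. *)
Lemma convex_ball_lebesgue_gt0 (Y A : set 'rV[R]_n) (y : 'rV[R]_n) (r : R) :
  closed Y -> convex_set (Y : set (convex_lmodType 'rV[R]_n)) ->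
  compact A -> A `<=` Y -> (0 < lebesgue_rV R n A)%E -> Y y -> 0 < r ->
  (0 < lebesgue_rV R n (Y `&` ball y r))%E.
Proof.
move=> cY convY cA AY A0 Yy r0.
have mN : measurable (Y `&` ball y r : set (borel_rV R n)).
  apply: measurableI; first exact: closed_measurable_rV.
  by apply: open_measurable_rV; exact: ball_open.
rewrite lt0e measure_ge0 andbT; apply/eqP => N0.
have [M [_ HM]] := compact_bounded cA.
pose c : R := `|M| + 1 + `|y|.
have c0 : 0 < c by rewrite /c ltr_wpDr// ltr_wpDl.
(* Ratio of the homothety: at most 1, so that convexity keeps the copy inside [Y], and at most
   [r / 2 / c], where [c] bounds the distance from [y] to points of [A]. *)
pose a := Num.min 1 (r / 2 / c).
have a0 : 0 < a by rewrite lt_min ltr01 !divr_gt0.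
have a1 : a <= 1 by rewrite ge_min lexx.
(* If the target set were null, so would be its preimage under the homothety; but that preimage
   contains [A]. *)
have := lebesgue_rV_affine_null ((1 - a) *: y) a0 mN N0.
apply/eqP; rewrite gt_eqF//; apply: (lt_le_trans A0).
apply: le_measure; rewrite ?inE; first exact: compact_measurable_rV.
  rewrite -[X in measurable X]setTI.
  exact: (@continuous_measurable_rV _ _ _ _ (@continuous_affine _ _ _ _)).
move=> u Au; split; first by apply: convex_setE => //; [exact: AY|exact: ltW].
rewrite -ball_normE /ball_/=.
have -> : y - (a *: u + (1 - a) *: y) = a *: (y - u).
  by apply/rowP => i; rewrite !mxE; ring.
rewrite normrZ gtr0_norm//.
have uM : `|y - u| <= c.
  rewrite (le_trans (ler_normB _ _))// addrC lerD2r.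
  by apply: HM => //; rewrite ltr_pwDr// ler_norm.
apply: (@le_lt_trans _ _ (a * c)); first by rewrite ler_pM2l.
apply: (@le_lt_trans _ _ (r / 2)); last by rewrite gtr_pMr// invf_lt1// ltr1n.
by rewrite -ler_pdivlMr// ge_min lexx orbT.
Qed.

End lebesgue_rV_compact.
(** * Gradients and differentiation under the integral *)

Section gradient.
Variables (R : realType) (d : nat).
Implicit Types (f : 'rV[R]_d -> R) (u v x G : 'rV[R]_d).

Lemma dotvDr u v w : dotv u (v + w) = dotv u v + dotv u w :> R.
Proof. by rewrite /dotv -big_split/=; apply: eq_bigr => i _; rewrite mxE mulrDr. Qed.

Lemma dotvZr u (a : R) v : dotv u (a *: v) = a * dotv u v.
Proof. by rewrite /dotv mulr_sumr; apply: eq_bigr => i _; rewrite mxE mulrCA. Qed.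

Lemma dotvC u v : dotv u v = dotv v u :> R.
Proof. by apply: eq_bigr => i _; rewrite mulrC. Qed.

Lemma dotvZl (a : R) u v : dotv (a *: u) v = a * dotv u v.
Proof. by rewrite dotvC dotvZr dotvC. Qed.

Lemma dotvDl u v w : dotv (u + v) w = dotv u w + dotv v w :> R.
Proof. by rewrite dotvC dotvDr ![dotv w _]dotvC. Qed.

Lemma dotvNr u v : dotv u (- v) = - dotv u v :> R.
Proof. by rewrite -scaleN1r dotvZr mulN1r. Qed.

Lemma dotvNl u v : dotv (- u) v = - dotv u v :> R.
Proof. by rewrite dotvC dotvNr dotvC. Qed.

Lemma dotv0r u : dotv u 0 = 0 :> R.
Proof. by rewrite -(scale0r 0) dotvZr mul0r. Qed.

Lemma dotv_delta u i : dotv u (delta_mx 0 i) = u 0 i :> R.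
Proof.
rewrite /dotv (bigD1 i)//= mxE !eqxx mulr1 big1 ?addr0// => j ji.
by rewrite mxE eqxx (negbTE ji) mulr0.
Qed.

(** The dual of the sup norm, hence the natural second factor when the pairing [dotv] is bounded by
    the library norm. *)
Definition l1norm v : R := \sum_i `|v 0 i|.

Lemma l1norm_ge0 v : 0 <= l1norm v.
Proof. by rewrite sumr_ge0. Qed.

Lemma dotv_le_l1 u v : `|dotv u v| <= `|u| * l1norm v.
Proof.
rewrite (le_trans (ler_norm_sum _ _ _))// mulr_sumr ler_sum// => i _.
by rewrite normrM ler_wpM2r// rV_coord_le.
Qed.

Lemma l1norm_le v : l1norm v <= d%:R * `|v|.
Proof.
rewrite -[X in X%:R]card_ord -sum1_card natr_sum mulr_suml ler_sum// => i _.
by rewrite mul1r rV_coord_le.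
Qed.

Lemma rV_norm_enorm u : `|u| <= enorm u.
Proof.
rewrite /enorm; apply: rV_norm_le; first exact: sqrtr_ge0.
move=> i; rewrite -sqrtr_sqr ler_wsqrtr// /dotv (bigD1 i)//= -expr2 lerDl.
by rewrite sumr_ge0// => j _; rewrite -expr2 sqr_ge0.
Qed.

Fact dotv_is_linear u : linear (dotv u : 'rV[R]_d -> R^o).
Proof. by move=> a x y; rewrite dotvDr dotvZr. Qed.

HB.instance Definition _ u :=
  GRing.isLinear.Build R 'rV[R]_d R^o _ (dotv u : 'rV[R]_d -> R^o) (dotv_is_linear u).

Lemma dotv_continuous u : continuous (dotv u : 'rV[R]_d -> R^o).
Proof.
move=> x; apply/(@cvgrPdist_lt R R^o _ (nbhs x)) => e e0.
pose c : R := `|u| * d%:R + 1.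
have c0 : 0 < c by rewrite ltr_wpDl// mulr_ge0.
near=> y.
rewrite [X in `|X|](_ : _ = dotv u (x - y)); last by rewrite dotvDr dotvNr.
rewrite (le_lt_trans (dotv_le_l1 _ _))//.
apply: (@le_lt_trans _ _ (c * `|x - y|)).
  rewrite (@le_trans _ _ (`|u| * (d%:R * `|x - y|)))//.
    by rewrite ler_wpM2l// l1norm_le.
  by rewrite mulrA ler_wpM2r// lerDl.
rewrite mulrC -ltr_pdivlMr//.
near: y; apply: (@cvgr_dist_lt _ _ _ _ _ id); last by rewrite divr_gt0.
exact: cvg_id.
Unshelve. all: by end_near. Qed.

Lemma differentiable_derive f x v : differentiable f x ->
  'd f x v = dotv (grad f x) v.
Proof.
move=> df; rewrite {1}(row_sum_delta v) linear_sum/=.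
by apply: eq_bigr => i _; rewrite linearZ/= -deriveE// /grad mxE mulrC.
Qed.

Lemma gradP f x (e : R) : differentiable f x -> 0 < e ->
  \forall h \near (0 : 'rV[R]_d),
    `|f (h + x) - f x - dotv (grad f x) h| <= e * `|h|.
Proof.
move=> df e0; have /diff_locally/eqaddoP/(_ _ e0) := df.
apply: filterS => h.
rewrite -![(_ + _ : _ -> _) _]/(_ + _) -![(- _ : _ -> _) _]/(- _) /=.
rewrite -![(_ + _ : _ -> _) _]/(_ + _) differentiable_derive//.
by rewrite opprD addrA.
Qed.

(** Converse of [gradP]: the differential is unique, so a first-order estimate proves
    differentiability and identifies the gradient at once. *)
Lemma differentiable_grad f x G :
  (forall e : R, 0 < e -> \forall h \near (0 : 'rV[R]_d),
    `|f (h + x) - f x - dotv G h| <= e * `|h|) ->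
  differentiable f x /\ grad f x = G.
Proof.
move=> H.
have E : f \o shift x = cst (f x) + (dotv G : 'rV[R]_d -> R^o) +o_ (0 : 'rV[R]_d) id.
  apply/eqaddoP => e e0; have := H _ e0; apply: filterS => h.
  rewrite -![(_ + _ : _ -> _) _]/(_ + _) -![(- _ : _ -> _) _]/(- _) /=.
  by rewrite -![(_ + _ : _ -> _) _]/(_ + _) opprD addrA.
have dE := @diff_unique R 'rV[R]_d R^o f (dotv G : 'rV[R]_d ->
  R^o) x (@dotv_continuous G) E.
have df : differentiable f x.
  apply/diff_locallyP; rewrite dE; split => //; exact: dotv_continuous.
split=> //; apply/rowP => i.
by rewrite -dotv_delta -differentiable_derive// dE; exact: dotv_delta.
Qed.

Lemma gradient_MVT f x h :
  (forall t : R, 0 <= t <= 1 -> differentiable f (x + t *: h)) ->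
  exists2 t : R, 0 <= t <= 1 & f (x + h) - f x = dotv (grad f (x + t *: h)) h.
Proof.
move=> df.
have dfi (t : R) : 0 <= t <= 1 ->
    is_derive t 1 (fun s : R => f (x + s *: h) : R^o) (dotv (grad f (x + t *: h)) h).
  move=> t01; pose l (s : R) := x + s *: h.
  have dl : is_diff t l (fun s => s *: h).
    have -> : l = cst x + *:%R^~ h by exact/funext.
  by rewrite -[X in is_diff _ _ X]add0r; exact: is_diffD.
  have dlt : differentiable l t by [].
  have dft : differentiable f (l t) by exact: df.
  have dcomp : differentiable (f \o l) t by exact: differentiable_comp.
  split; first exact: diff_derivable.
  rewrite deriveE// diff_comp//= [X in 'd f _ X](_ : _ = h).
    exact: differentiable_derive.
  by rewrite diff_val scale1r.
have [||t t01 E] := @MVT_segment R (fun s : R => f (x + s *: h))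
    (fun t => dotv (grad f (x + t *: h)) h) 0 1 ler01.
- by move=> t; rewrite in_itv/= => /andP[/ltW t0 /ltW t1]; apply: dfi; rewrite t0.
- apply: derivable_within_continuous => t; rewrite in_itv/= => t01.
  by have [] := dfi _ t01.
exists t; first by move: t01; rewrite in_itv.
by move: E; rewrite scale1r scale0r addr0 subr0 mulr1.
Qed.

End gradient.

(** * Topology of concatenated vectors *)

Section row_mx_topology.
Variables (R : realType) (n m : nat).

Lemma cvg_near_eq (T U : topologicalType) (x : T) (f g : T -> U) (l : U) :
  (\forall x' \near x, f x' = g x') ->
  g x' @[x' --> x] --> l -> f x' @[x' --> x] --> l.
Proof.
move=> fg; apply: cvg_trans; apply: near_eq_cvg; near=> x'; apply/esym; near: x'.
exact: fg.
Unshelve. all: by end_near. Qed.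

Lemma near_norm_lt (V : normedModType R) (x : V) (e : R) : 0 < e ->
  \forall x' \near x, `|x - x'| < e.
Proof. by move=> e0; apply/nbhs_normP; exists e. Qed.

Lemma cvg_row_mx (x : 'rV[R]_n) (y : 'rV[R]_m) :
  row_mx p.1 p.2 @[p --> filter_prod (nbhs x) (nbhs y)] --> row_mx x y.
Proof.
apply/cvgrPdist_lt => e e0; have e2 : 0 < e / 2 by rewrite divr_gt0.
exists ([set x' | `|x - x'| < e / 2], [set y' | `|y - y'| < e / 2]) => /=.
  by split; [exact: (near_norm_lt x e2)|exact: (near_norm_lt y e2)].
move=> [x' y'] /= [xx' yy'].
rewrite opp_row_mx add_row_mx (le_lt_trans (norm_row_mx _ _))//.
by rewrite [e]splitr ltrD.
Qed.

Lemma cvg_row_mxr (x : 'rV[R]_n) (y : 'rV[R]_m) :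
  row_mx x y' @[y' --> y] --> row_mx x y.
Proof.
apply/(@cvgrPdist_lt _ _ _ (nbhs y)) => e e0; apply: filterS (near_norm_lt y e0) => y'.
by rewrite opp_row_mx add_row_mx subrr; apply: le_lt_trans;
  rewrite (le_trans (norm_row_mx _ _))// normr0 add0r.
Qed.

Lemma dotv_row_mx (u : 'rV[R]_(n + m)) (a : 'rV[R]_n) (b : 'rV[R]_m) :
  dotv u (row_mx a b) = dotv (lsubmx u) a + dotv (rsubmx u) b.
Proof.
rewrite /dotv big_split_ord/=; congr (_ + _); apply: eq_bigr => i _.
  by rewrite row_mxEl !mxE.
by rewrite row_mxEr !mxE.
Qed.

(** Each [y] in [K] has a product neighborhood on which [psi] stays within [e / 2] of
    [psi (row_mx x y)]; the near-covering form of compactness makes the neighborhood of [x]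
    independent of [y]. *)
Lemma compact_slice_continuous (V : normedModType R) (psi : 'rV[R]_(n + m) -> V)
    (x : 'rV[R]_n) (K : set 'rV[R]_m) : compact K ->
  (forall y, K y -> {for row_mx x y, continuous psi}) ->
  forall e : R, 0 < e -> \forall x' \near x, forall y, K y ->
    `|psi (row_mx x y) - psi (row_mx x' y)| < e.
Proof.
move=> /compact_near_coveringP cK cpsi e e0.
apply: (cK _ (nbhs x) (fun x' y => `|psi (row_mx x y) - psi (row_mx x' y)| < e)).
move=> y Ky; have e2 : 0 < e / 2 by rewrite divr_gt0.
have /cvgrPdist_lt/(_ _ e2) C := cpsi y Ky.
have [[A B] /= [nA nB] AB] := cvg_row_mx C.
exists (B, A) => //= -[y' x'] /= [By' Ax'].
have H1 := AB (x', y') (conj Ax' By'); have H2 := AB (x,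
  y') (conj (nbhs_singleton nA) By').
rewrite /= in H1 H2.
rewrite -(subrKA (psi (row_mx x y))) [e]splitr (le_lt_trans (ler_normD _ _))//.
by rewrite ltrD// distrC.
Qed.

Lemma open_setX_rV (A : set 'rV[R]_n) (B : set 'rV[R]_m) :
  open A -> open B -> open (setX_rV A B).
Proof.
move=> oA oB; apply: openI.
  by apply: open_comp oA => z _; exact: (differentiable_continuous
    (differentiable_lsubmx _)).
by apply: open_comp oB => z _; exact: (differentiable_continuous
  (differentiable_rsubmx _)).
Qed.

Lemma setX_rV_row_mx (A : set 'rV[R]_n) (B : set 'rV[R]_m) x y :
  A x -> B y -> setX_rV A B (row_mx x y).
Proof. by move=> Ax By; split; rewrite ?row_mxKl ?row_mxKr. Qed.

End row_mx_topology.

Section gradient_calculus.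
Variables (R : realType) (d : nat).

Lemma grad_comp (f : 'rV[R]_d -> R) (g : R -> R) z :
  differentiable f z -> derivable g (f z) 1 ->
  differentiable (g \o f) z /\ grad (g \o f) z = (derive1 g) (f z) *: grad f z.
Proof.
move=> df /derivable1_diffP dg.
have dc : differentiable (g \o f) z by exact: differentiable_comp.
split=> //; apply/rowP => i.
rewrite mxE [RHS]mxE [in RHS]mxE !deriveE// diff_comp//= diff1E//=.
by rewrite mulrC.
Qed.

Lemma continuously_differentiable_comp (f : 'rV[R]_d -> R) (g : R -> R) O :
  open O -> continuously_differentiable O f ->
  (forall z, O z -> derivable g (f z) 1 /\ {for f z, continuous (derive1 g)}) ->
  continuously_differentiable O (g \o f).
Proof.
move=> oO [df cf] H; split=> z Oz.
  by have [dg _] := H _ Oz; have [] := grad_comp (df _ Oz) dg.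
have [dg cg] := H _ Oz.
rewrite /prop_for /continuous_at (grad_comp (df _ Oz) dg).2.
apply: (@cvg_near_eq _ _ z _ (fun z => derive1 g (f z) *: grad f z)).
  have : \forall z' \near z, O z' by exact: open_nbhs_nbhs.
  apply: filterS => z' Oz'; have [dg' _] := H _ Oz'.
  exact: (grad_comp (df _ Oz') dg').2.
apply: (@cvgZ _ _ _ (nbhs z) _ (derive1 g \o f) (grad f)); last exact: cf.
apply: (@continuous_comp _ _ _ f (derive1 g)) => //.
exact: differentiable_continuous (df _ Oz).
Qed.

End gradient_calculus.

Section partial_gradient.
Variables (R : realType) (n m : nat).

Lemma partial_gradient (phi : 'rV[R]_(n + m) -> R) x y :
  differentiable phi (row_mx x y) ->
  differentiable (fun x' => phi (row_mx x' y)) x /\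
  gradx phi x y = lsubmx (grad phi (row_mx x y)).
Proof.
move=> dphi; apply: differentiable_grad => e e0.
have /nbhs_norm0P[r /= r0 H] := gradP dphi e0.
apply/nbhs_norm0P; exists r => //= h hr.
have h0 : `|row_mx h (0 : 'rV[R]_m)| <= `|h|.
  by rewrite (le_trans (norm_row_mx _ _))// normr0 addr0.
have := H (row_mx h 0) (le_lt_trans h0 hr).
rewrite add_row_mx add0r dotv_row_mx dotv0r addr0 => /le_trans; apply.
by rewrite ler_wpM2l// ltW.
Qed.

End partial_gradient.

(** * Differentiation under the integral over a compact set *)

Section integral_gradient.
Variables (R : realType) (n m : nat).
Variables (OX : set 'rV[R]_n) (OY K : set 'rV[R]_m).
Hypotheses (oOX : open OX) (oOY : open OY) (cK : compact K) (KOY : K `<=` OY).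
Local Notation lam := (lebesgue_rV R m).

Lemma continuous_slice (V : topologicalType) (psi : 'rV[R]_(n + m) -> V) x :
  (forall z, setX_rV OX OY z -> {for z, continuous psi}) -> OX x ->
  {in OY, continuous (fun y => psi (row_mx x y))}.
Proof.
move=> cpsi Ox y /set_mem Oy.
apply: (@continuous_comp _ _ _ (fun y => row_mx x y) psi); first exact: cvg_row_mxr.
by apply: cpsi; exact: setX_rV_row_mx.
Qed.

Lemma integrable_slice (psi : 'rV[R]_(n + m) -> R) x :
  (forall z, setX_rV OX OY z -> {for z, continuous psi}) -> OX x ->
  lam.-integrable K (EFin \o (fun y => psi (row_mx x y))).
Proof.
move=> cpsi Ox; apply: (continuous_integrable_rV oOY) => //.
exact: continuous_slice.
Qed.

Lemma Rintegral_sum_rV (I : Type) (s : seq I) (f : I -> 'rV[R]_m -> R) :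
  (forall i, lam.-integrable K (EFin \o f i)) ->
  lam.-integrable K (EFin \o (fun y => \sum_(i <- s) f i y)) /\
  \int[lam]_(y in K) (\sum_(i <- s) f i y) = \sum_(i <- s) \int[lam]_(y in K) f i y.
Proof.
move=> If; have mK := compact_measurable_rV cK.
elim: s => [|i s [IH1 IH2]].
  under eq_Rintegral do rewrite big_nil.
  rewrite big_nil Rintegral_cst// mul0r; split=> //.
  rewrite (_ : EFin \o _ = cst 0%E); first exact: integrable0.
  by apply/funext => y /=; rewrite big_nil.
have -> : (fun y => \sum_(j <- i :: s) f j y) = (fun y => f i y + \sum_(j <- s) f j y).
  by apply/funext => y; rewrite big_cons.
rewrite RintegralD// IH2 big_cons; split=> //.
have := integrableD mK (If i) IH1.
by congr (_.-integrable _ _); apply/funext => y /=; rewrite EFinD.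
Qed.

Variable phi : 'rV[R]_(n + m) -> R.
Hypothesis dphi : continuously_differentiable (setX_rV OX OY) phi.

Definition integral_gradx x : 'rV[R]_n := \row_i \int[lam]_(y in K) gradx phi x y 0 i.

Let F x := \int[lam]_(y in K) phi (row_mx x y).

Let cphi z : setX_rV OX OY z -> {for z, continuous phi}.
Proof. by move=> Oz; apply: differentiable_continuous; exact: dphi.1. Qed.

Let gradxE x y : OX x -> OY y -> gradx phi x y = lsubmx (grad phi (row_mx x y)).
Proof.
by move=> Ox Oy; have [] := partial_gradient (dphi.1 _ (setX_rV_row_mx Ox Oy)).
Qed.

Let cgradx i : forall z, setX_rV OX OY z ->
  {for z, continuous (fun z => gradx phi (lsubmx z) (rsubmx z) 0 i)}.
Proof.
move=> z Oz; rewrite /prop_for /continuous_at.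
have [Ox Oy] := Oz.
rewrite gradxE// hsubmxK mxE.
apply: (@cvg_near_eq _ _ z _ (fun z => grad phi z 0 (lshift m i))).
  have : \forall z' \near z, setX_rV OX OY z' by apply: open_nbhs_nbhs; split => //;
    exact: open_setX_rV.
  by apply: filterS => z' [Ox' Oy']; rewrite gradxE// hsubmxK mxE.
apply: (@continuous_comp _ _ _ (grad phi) (fun u => u 0 (lshift m i)));
  first exact: dphi.2.
exact: coord_continuous.
Qed.

Lemma integrable_gradx x i : OX x ->
  lam.-integrable K (EFin \o (fun y => gradx phi x y 0 i)).
Proof.
move=> Ox; have := integrable_slice (@cgradx i) Ox.
by congr (_.-integrable _ _); apply/funext => y /=; rewrite row_mxKl row_mxKr.
Qed.

Lemma integrable_dotv_gradx x h : OX x ->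
  lam.-integrable K (EFin \o (fun y => dotv (gradx phi x y) h)) /\
  \int[lam]_(y in K) dotv (gradx phi x y) h = dotv (integral_gradx x) h.
Proof.
move=> Ox; have mK := compact_measurable_rV cK.
have Ii i : lam.-integrable K (EFin \o (fun y => gradx phi x y 0 i * h 0 i)).
  have := integrableZr mK (h 0 i) (integrable_gradx i Ox).
  by congr (_.-integrable _ _).
have [I1 I2] := Rintegral_sum_rV (index_enum 'I_n) Ii.
split; first exact: I1.
rewrite [LHS]I2; apply: eq_bigr => i _; rewrite mxE RintegralZr//.
exact: integrable_gradx.
Qed.

Let uniform_gradx x (e : R) : OX x -> 0 < e ->
  exists2 r : R, 0 < r & forall x', `|x' - x| < r -> OX x' /\
    forall y, K y -> `|gradx phi x' y - gradx phi x y| <= e.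
Proof.
move=> Ox e0.
have A : \forall x' \near x, OX x' by exact: open_nbhs_nbhs.
have B := compact_slice_continuous cK (fun y Ky =>
  dphi.2 _ (setX_rV_row_mx Ox (KOY Ky))) e0.
have /nbhs_normP[r /= r0 H] : \forall x' \near x, OX x' /\ forall y, K y ->
  `|grad phi (row_mx x y) - grad phi (row_mx x' y)| < e by exact: filterI A B.
exists r => // x' xr; have [|Ox' H2] := H x'; first by rewrite /= distrC.
split=> // y Ky; rewrite !gradxE//; [|exact: KOY..].
have := ltW (H2 y Ky); rewrite distrC; apply: le_trans.
rewrite -linearB; set u := grad _ _ - _.
by rewrite -{2}(hsubmxK u); exact: norm_row_mxl.
Qed.

Let volK := fine (lam K).
Let volK_ge0 : 0 <= volK. Proof. by rewrite fine_ge0. Qed.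

Lemma Rintegral_le_cst (f : 'rV[R]_m -> R) (c : R) :
  lam.-integrable K (EFin \o f) -> (forall y, K y -> f y <= c) ->
  \int[lam]_(y in K) f y <= c * volK.
Proof.
move=> If H; have mK := compact_measurable_rV cK.
rewrite -Rintegral_cst//; apply: le_Rintegral => //.
apply: (continuous_integrable_rV (U := setT)) => //; first exact: openT.
by move=> y _; exact: cst_continuous.
Qed.

Lemma normr_Rintegral_le_cst (f : 'rV[R]_m -> R) (c : R) :
  lam.-integrable K (EFin \o f) -> (forall y, K y -> `|f y| <= c) ->
  `|\int[lam]_(y in K) f y| <= c * volK.
Proof.
move=> If H; have mK := compact_measurable_rV cK.
rewrite (le_trans (le_normr_Rintegral _ _))//; apply: Rintegral_le_cst => //.
exact: integrable_norm.
Qed.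

(** The mean value theorem turns the first-order error at each [y] into a difference of partial
    gradients, which is uniformly small over the compact [K]; this error is then integrated. *)
Lemma differentiable_integral x : OX x ->
  differentiable F x /\ grad F x = integral_gradx x.
Proof.
move=> Ox; have mK := compact_measurable_rV cK.
apply: differentiable_grad => e e0.
(* Absorbs the volume of [K] and the factor [n] from comparing [l1norm h] with the sup norm of [h];
   the added ones keep it positive. *)
pose c : R := (volK + 1) * (n%:R + 1).
have c0 : 0 < c by rewrite mulr_gt0// ltr_wpDl.
have [r r0 H] := uniform_gradx Ox (divr_gt0 e0 c0).
apply/nbhs_norm0P; exists r => //= h hr.
have Ohx t : 0 <= t <= 1 -> OX (x + t *: h) /\
    forall y, K y -> `|gradx phi (x + t *: h) y - gradx phi x y| <= e / c.
  move=> /andP[t0 t1]; apply: H; rewrite addrC addKr normrZ ger0_norm//.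
  by rewrite (le_lt_trans _ hr)// ler_piMl.
have Oh : OX (h + x).
  by have [|] := Ohx 1; rewrite ?lexx ?ler01// scale1r addrC.
have [Id <-] := integrable_dotv_gradx h Ox.
have If := integrable_slice cphi Ox; have Ifh := integrable_slice cphi Oh.
rewrite /F -RintegralB// -RintegralB//; last first.
  have := integrableB mK Ifh If.
  by congr (_.-integrable _ _).
apply: (@le_trans _ _ (e / c * (n%:R * `|h|) * volK)).
  apply: normr_Rintegral_le_cst.
    have := integrableB mK (integrableB mK Ifh If) Id.
    by congr (_.-integrable _ _).
  move=> y Ky.
  have [|t t01 E] := @gradient_MVT _ _ (fun x' => phi (row_mx x' y)) x h.
    move=> t t01; have [Oxt _] := Ohx t t01.
    by have [] := partial_gradient (dphi.1 _ (setX_rV_row_mx Oxt (KOY Ky))).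
  rewrite [h + x]addrC E -dotvNl -dotvDl (le_trans (dotv_le_l1 _ _))//.
  have [_ Hy] := Ohx t t01.
  by rewrite ler_pM ?l1norm_ge0 ?l1norm_le//; exact: Hy.
rewrite [leRHS](_ : _ = e / c * `|h| * c); last by field; rewrite gt_eqF.
rewrite -!mulrA ler_pM2l// ler_pM2l ?invr_gt0// mulrCA ler_wpM2l//.
by rewrite mulrC /c ler_pM// lerDl.
Qed.

Lemma continuously_differentiable_integral : continuously_differentiable OX F.
Proof.
have mK := compact_measurable_rV cK.
split=> x Ox; first by have [] := differentiable_integral Ox.
rewrite /prop_for /continuous_at (differentiable_integral Ox).2.
apply: (@cvg_near_eq _ _ x _ integral_gradx).
  have : \forall x' \near x, OX x' by exact: open_nbhs_nbhs.
  by apply: filterS => x' Ox'; exact: (differentiable_integral Ox').2.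
apply/(@cvgrPdist_le _ _ _ (nbhs x)) => e e0.
have [r r0 H] := uniform_gradx Ox (divr_gt0 e0 (ltr_wpDl volK_ge0 ltr01)).
apply: filterS (near_norm_lt x r0) => x' xr.
have [|Ox' {}H] := H x'; first by rewrite distrC.
rewrite distrC; apply: rV_norm_le => [|i]; first exact: ltW.
rewrite !mxE -RintegralB//; [|exact: integrable_gradx..].
apply: (@le_trans _ _ (e / (volK + 1) * volK)).
  apply: normr_Rintegral_le_cst.
    have := integrableB mK (integrable_gradx i Ox') (integrable_gradx i Ox).
    by congr (_.-integrable _ _).
  move=> y Ky; apply: le_trans (H y Ky).
  rewrite (_ : _ - _ = (gradx phi x' y - gradx phi x y) 0 i); last by rewrite !mxE.
  exact: rV_coord_le.
rewrite mulrAC ler_pdivrMr ?ltr_wpDl// ler_wpM2l ?ltW//.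
by rewrite ltrDl.
Qed.

End integral_gradient.
(** * Sublinear functionals and Clarke derivatives *)

Section sublinear.
Variables (R : realType) (d : nat).
Local Notation V := 'rV[R]_d.
Implicit Types (p q : V -> R) (C : set (V * R)).

Definition sublinear p : Prop :=
  (forall u v, p (u + v) <= p u + p v) /\
  (forall (a : R) u, 0 <= a -> p (a *: u) = a * p u).

(** A pair [(w, r)] of [C] encodes a demand: the linear functional sought must be at least [r] at
    [w]. Demands can be added and scaled, whence the cone. *)
Definition convex_cone C : Prop :=
  [/\ C (0, 0), forall b c, C b -> C c -> C (b.1 + c.1, b.2 + c.2) &
      forall (a : R) c, 0 <= a -> C c -> C (a *: c.1, a * c.2)].

Lemma sublinear0 p : sublinear p -> p 0 = 0.
Proof. by move=> [_ ph]; rewrite -(scale0r 0) ph// mul0r. Qed.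

Lemma sublinearN p u : sublinear p -> - p (- u) <= p u.
Proof.
move=> sp; rewrite -subr_ge0 opprK addrC -[leLHS](sublinear0 sp) -(addNr u) addrC.
by rewrite addrC; exact: sp.1.
Qed.

(** [q w] is the infimum of [p (w + c.1) - c.2] over [c] in [C]. It is finite because subadditivity
    and [c.2 <= p c.1] bound these values below by [- p (- w)]. Taking [c = (0, 0)] gives [q <= p],
    and evaluating at [- c.1] gives the last bound, by which any linear functional below [q] meets
    every demand. *)
Lemma sublinear_extend p C : sublinear p -> convex_cone C ->
  (forall c, C c -> c.2 <= p c.1) ->
  exists q, [/\ sublinear q, forall w, q w <= p w &
    forall c, C c -> q (- c.1) <= - c.2].
Proof.
move=> sp [C0 CD CZ] Cp.
pose A w := [set p (w + c.1) - c.2 | c in C].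
have lbA w : lbound (A w) (- p (- w)).
  move=> _ [c Cc <-].
  have := sp.1 (- w) (w + c.1); rewrite addKr => H.
  by have := Cp c Cc; lra.
have hA w : has_inf (A w).
  split; last by exists (- p (- w)).
  by exists (p (w + 0) - 0); exists (0, 0).
pose q w := inf (A w).
have qle w c : C c -> q w <= p (w + c.1) - c.2.
  by move=> Cc; apply: ge_inf; [exact: (hA w).2|exists c].
have leq w (r : R) : (forall c, C c -> r <= p (w + c.1) - c.2) -> r <= q w.
  move=> H; apply: lb_le_inf; first exact: (hA w).1.
  by move=> _ [c Cc <-]; exact: H.
have qZ (a : R) w : 0 < a -> q (a *: w) <= a * q w.
  move=> a0; rewrite -ler_pdivrMl//; apply: leq => c Cc.
  rewrite ler_pdivrMl//.
  have := qle (a *: w) _ (CZ a c (ltW a0) Cc); rewrite /= -scalerDr sp.2;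
    last exact: ltW.
  by rewrite mulrBr.
exists q; split.
- split=> [u v|a u].
    suff H : q (u + v) - q v <= q u by rewrite -lerBlDr.
    apply: (leq u) => b Cb; rewrite lerBlDr -lerBlDl.
    apply: (leq v) => c Cc.
    have := qle (u + v) _ (CD b c Cb Cc) => /=.
    have := sp.1 (u + b.1) (v + c.1); rewrite addrACA; lra.
  rewrite le_eqVlt => /predU1P[<-|a0].
    rewrite scale0r mul0r; apply/eqP; rewrite eq_le; apply/andP; split.
      by have := qle 0 _ C0; rewrite /= addr0 (sublinear0 sp) subr0.
    by apply: leq => c Cc; rewrite add0r subr_ge0; exact: Cp.
  apply/eqP; rewrite eq_le qZ//= -ler_pdivlMl//.
  rewrite -{1}(scale1r u) -(mulVf (lt0r_neq0 a0)) -scalerA.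
  by rewrite qZ// invr_gt0.
- by move=> w; have := qle w _ C0; rewrite /= addr0 subr0.
- by move=> c Cc; have := qle (- c.1) _ Cc; rewrite addNr sublinear0// sub0r.
Qed.

(** One vector at a time: extending by the ray of demands through [(v, q v)] makes the functional
    odd at [v]. *)
Lemma sublinear_pin p (s : seq V) : sublinear p ->
  exists q, [/\ sublinear q, forall w, q w <= p w &
    forall v, v \in s -> q (- v) = - q v].
Proof.
move=> sp; elim: s => [|v s [q [sq qp qs]]]; first by exists p.
pose C : set (V * R) := [set (a *: v, a * q v) | a in [set a | 0 <= a]].
have [||r [sr rq rC]] := @sublinear_extend q C sq.
- split.
  + by exists 0 => //=; rewrite scale0r mul0r.
  + move=> _ _ [a a0 <-] [b b0 <-]; exists (a + b) => /=; first exact: addr_ge0.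
    by rewrite scalerDl mulrDl.
  + move=> a _ a0 [b b0 <-]; exists (a * b) => /=; first exact: mulr_ge0.
    by rewrite scalerA mulrA.
- by move=> _ [a a0 <-] /=; rewrite sq.2.
exists r; split => // [w|u]; first exact: le_trans (rq w) (qp w).
(* Where [q] is already odd there is no room to decrease: [q w <= - r (- w) <= r w <= q w]. Hence
   earlier vectors stay pinned. *)
have E w : q (- w) <= - q w -> r w = q w /\ r (- w) = - q w.
  move=> qw; have h1 := rq w; have h2 := rq (- w); have h3 := sublinearN w sr.
  by split; lra.
rewrite inE => /predU1P[->|us]; last first.
  by have [] := E u; [rewrite qs|move=> -> ->].
have h := rC (v, q v); have {h} : r (- v) <= - q v.
  by apply: h; exists 1; rewrite /= ?scale1r ?mul1r.
by have := rq v; have := sublinearN v sr; lra.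
Qed.

(* Finite-dimensional Hahn-Banach: a functional pinned along a basis is linear. *)
Lemma sublinear_dominates p : sublinear p ->
  exists eta : V, forall w, dotv eta w <= p w.
Proof.
move=> sp; pose e i : V := delta_mx 0 i.
have [q [sq qp qe]] := sublinear_pin [seq e i | i <- enum 'I_d] sp.
have qeN i : q (- e i) = - q (e i) by apply: qe; apply: map_f; rewrite mem_enum.
have qZ i (a : R) : q (a *: e i) = a * q (e i).
  have [a0|a0] := leP 0 a; first by rewrite sq.2.
  rewrite -[a *: e i]opprK -scaleNr -scalerN sq.2 ?oppr_ge0 ?ltW// qeN.
  by rewrite mulrNN.
have qsum (s : seq 'I_d) (u : 'I_d -> V) :
  q (\sum_(i <- s) u i) <= \sum_(i <- s) q (u i).
  elim: s => [|i s IH]; first by rewrite !big_nil sublinear0.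
  by rewrite !big_cons (le_trans (sq.1 _ _))// lerD2l.
pose eta : V := \row_i q (e i); exists eta => w.
(* Subadditivity along the coordinates gives the inequality opposite to the desired one; applying it
   at [- w] reverses it, since [- q (- w) <= q w]. *)
have qle v : q v <= dotv eta v.
  rewrite {1}(row_sum_delta v) (le_trans (qsum _ _))//.
  by apply: ler_sum => i _; rewrite qZ mxE mulrC.
apply: le_trans (qp w).
by have := qle (- w); rewrite dotvNr; have := sublinearN w sq; lra.
Qed.

Lemma sublinear_sandwich p C : sublinear p -> convex_cone C ->
  (forall c, C c -> c.2 <= p c.1) ->
  exists2 eta : V, forall w, dotv eta w <= p w &
    forall c, C c -> c.2 <= dotv eta c.1.
Proof.
move=> sp CC Cp; have [q [sq qp qC]] := sublinear_extend sp CC Cp.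
have [eta Heta] := sublinear_dominates sq.
exists eta => [w|c Cc]; first exact: le_trans (Heta w) (qp w).
by have := Heta (- c.1); rewrite dotvNr; have := qC c Cc; lra.
Qed.

(** The ray of demands through [(v, p v)] forces equality at [v]. *)
Lemma sublinear_support p v : sublinear p ->
  exists2 eta : V, forall w, dotv eta w <= p w & dotv eta v = p v.
Proof.
move=> sp; pose C : set (V * R) := [set (a *: v, a * p v) | a in [set a | 0 <= a]].
have [||eta H1 H2] := @sublinear_sandwich p C sp.
- split.
  + by exists 0 => //=; rewrite scale0r mul0r.
  + move=> _ _ [a a0 <-] [b b0 <-]; exists (a + b) => /=; first exact: addr_ge0.
    by rewrite scalerDl mulrDl.
  + move=> a _ a0 [b b0 <-]; exists (a * b) => /=; first exact: mulr_ge0.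
    by rewrite scalerA mulrA.
- by move=> _ [a a0 <-] /=; rewrite sp.2.
exists eta => //; apply/eqP; rewrite eq_le H1/=.
by apply: (H2 (v, p v)); exists 1; rewrite /= ?scale1r ?mul1r.
Qed.

End sublinear.

(** * Clarke derivatives of Lipschitz functions *)

Section clarke_theory.
Variables (R : realType) (d : nat).
Implicit Types (f : 'rV[R]_d -> R) (z w xi : 'rV[R]_d).

Definition lipschitz_with (L : R) f := forall u v, `|f u - f v| <= L * `|u - v|.

Definition quotient f w z (t : R) : R := (f (z + t *: w) - f z) / t.

Lemma clarke_dd_le f z w (c : R) :
  (\forall z' \near z & t \near 0^'+, quotient f w z' t <= c) ->
  (clarke_dd f z w <= c%:E)%E.
Proof.
move=> H; apply: (@le_trans _ _ (ereal_sup [set (quotient f w p.1 p.2)%:E |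
    p in [set p | quotient f w p.1 p.2 <= c]])).
  by apply: ereal_inf_lbound; exists [set p | quotient f w p.1 p.2 <= c].
by apply: ub_ereal_sup => _ [p /= pc <-]; rewrite lee_fin.
Qed.

Lemma clarke_dd_lt f z w (c : R) : (clarke_dd f z w < c%:E)%E ->
  \forall z' \near z & t \near 0^'+, quotient f w z' t < c.
Proof.
move=> /ereal_inf_lt[_ [A FA <-]] sc; apply: filterS FA => p Ap.
rewrite -lte_fin; apply: le_lt_trans sc.
by apply: ereal_sup_ubound; exists p.
Qed.

(** The base point may be kept at [z], which belongs to each of its neighborhoods. *)
Lemma clarke_dd_ge f z w (c : R) :
  (\forall t \near 0^'+, c <= quotient f w z t) -> (c%:E <= clarke_dd f z w)%E.
Proof.
move=> H; rewrite leNgt; apply/negP => /clarke_dd_lt[[A B] /= [nA nB] AB].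
have HB : \forall t \near 0^'+, c <= quotient f w z t /\ B t by exact: filterI.
have [t [ct Bt]] := @filter_ex _ _ (at_right_proper_filter (0 : R)) _ HB.
by have := AB (z, t) (conj (nbhs_singleton nA) Bt); rewrite /= ltNge ct.
Qed.

Lemma near_prod_right_gt0 z : \forall p \near filter_prod (nbhs z) (0 : R)^'+, 0 < p.2.
Proof.
exists (setT, [set t | 0 < t]); last by move=> p [].
by split; [exact: filterT|exact: nbhs_right_gt].
Qed.

Lemma cvg_line z w :
  p.1 + p.2 *: w @[p --> filter_prod (nbhs z) (0 : R)^'+] --> z.
Proof.
have h2 : p.2 @[p --> filter_prod (nbhs z) (0 : R)^'+] --> (0 : R).
  by apply: cvg_trans cvg_snd _; exact: cvg_within.
rewrite -[X in _ --> X]addr0 -(scale0r w).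
by apply: cvgD; [exact: cvg_fst|exact: (cvgZr_tmp h2)].
Qed.

Section lipschitz.
Variables (L : R) (f : 'rV[R]_d -> R).
Hypothesis Lf : lipschitz_with L f.

Lemma quotient_lipschitz w z t : 0 < t -> `|quotient f w z t| <= L * `|w|.
Proof.
move=> t0; rewrite /quotient normrM normfV (gtr0_norm t0) ler_pdivrMr//.
rewrite (le_trans (Lf _ _))// [z + _]addrC addrK normrZ (gtr0_norm t0).
by rewrite mulrCA mulrC.
Qed.

Lemma clarke_dd_le_lipschitz z w : (clarke_dd f z w <= (L * `|w|)%:E)%E.
Proof.
apply: clarke_dd_le; apply: filterS (near_prod_right_gt0 z) => -[z' t] /= t0.
by rewrite (le_trans (ler_norm _))// quotient_lipschitz.
Qed.

Lemma clarke_dd_fin_num z w : clarke_dd f z w \is a fin_num.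
Proof.
rewrite fin_real// (le_lt_trans (clarke_dd_le_lipschitz z w)) ?ltry// andbT.
apply: (@lt_le_trans _ _ (- (L * `|w|))%:E); first exact: ltNyr.
apply: clarke_dd_ge; near=> t.
have t0 : 0 < t by near: t; exact: nbhs_right_gt.
by have := quotient_lipschitz w z t0; rewrite ler_norml => /andP[].
Unshelve. all: by end_near. Qed.

(** The real-valued form of [clarke_dd], faithful for Lipschitz [f], where the extended value is
    finite. *)
Definition clarke_dir z w := fine (clarke_dd f z w).

Lemma clarke_dirE z w : (clarke_dir z w)%:E = clarke_dd f z w.
Proof. exact/fineK/clarke_dd_fin_num. Qed.

Lemma clarke_dir_le z w (c : R) :
  (\forall z' \near z & t \near 0^'+, quotient f w z' t <= c) -> clarke_dir z w <= c.
Proof. by move=> /clarke_dd_le; rewrite -clarke_dirE lee_fin. Qed.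

Lemma clarke_dir_ge z w (c : R) :
  (\forall t \near 0^'+, c <= quotient f w z t) -> c <= clarke_dir z w.
Proof. by move=> /clarke_dd_ge; rewrite -clarke_dirE lee_fin. Qed.

Lemma clarke_dir_lt z w (c : R) : clarke_dir z w < c ->
  \forall z' \near z & t \near 0^'+, quotient f w z' t < c.
Proof. by move=> h; apply: clarke_dd_lt; rewrite -clarke_dirE lte_fin. Qed.

Lemma clarkeP z xi : clarke f z xi <-> forall w, dotv xi w <= clarke_dir z w.
Proof. by split=> H w; have := H w; rewrite -clarke_dirE lee_fin. Qed.

(** Homogeneity: the quotient along [a *: w] with step [t] is [a] times the quotient along [w] with
    step [a * t]; one inequality is enough, the other being its instance at the inverse of [a].
    Subadditivity: the quotient along [u + v] at [z'] is the one along [v] at [z'] plus the one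
    along [u] at [z' + t *: v], a base point that still tends to [z]. *)
Lemma clarke_dir_sublinear z : sublinear (clarke_dir z).
Proof.
have pZ (a : R) w : 0 < a -> clarke_dir z (a *: w) <= a * clarke_dir z w.
  move=> a0; apply/ler_addgt0Pr => e e0.
  have /clarke_dir_lt[[A B] /= [nA nB] AB] : clarke_dir z w < clarke_dir z w + e / a.
    by rewrite ltrDl divr_gt0.
  apply: clarke_dir_le.
  have nB' : \forall t \near 0^'+, B (a * t).
    have [r /= r0 rB] := nB.
    exists (r / a) => [/=|t /= tr t0]; first by rewrite divr_gt0.
    apply: rB; last by rewrite mulr_gt0.
    move: tr; rewrite /= !sub0r !normrN normrM (gtr0_norm a0).
    by rewrite ltr_pdivlMr// mulrC.
  have : \forall z' \near z & t \near 0^'+, [/\ A z', B (a * t) & 0 < t].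
    exists (A, [set t | B (a * t) /\ 0 < t]) => /=; last by move=> [z' t] /= [? []].
    by split=> //; apply: filterI => //; exact: nbhs_right_gt.
  apply: filterS => -[z' t] /= [Az' Bt t0].
  have := AB (z', a * t) (conj Az' Bt); rewrite /quotient /=.
  rewrite scalerA [t * a]mulrC => /ltW.
  rewrite ler_pdivrMr ?mulr_gt0// ler_pdivrMr//.
  by rewrite (_ : (_ + e / a) * (a * t) = (a * clarke_dir z w + e) * t)//; field;
    rewrite gt_eqF.
split=> [u v|a u].
  apply/ler_addgt0Pr => e e0; have e2 : 0 < e / 2 by rewrite divr_gt0.
  have Hu : clarke_dir z u < clarke_dir z u + e / 2 by rewrite ltrDl.
  have Hv : clarke_dir z v < clarke_dir z v + e / 2 by rewrite ltrDl.
  apply: clarke_dir_le.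
  have Cv := clarke_dir_lt Hv.
  have [[A B] /= [nA nB] AB] := clarke_dir_lt Hu.
  have nA' : \forall z' \near z & t \near 0^'+, A (z' + t *: v) by exact: cvg_line nA.
  have nB' : \forall z' \near z & t \near 0^'+, B t.
    by exists (setT, B) => [|[z' t] []//]; split=> //; exact: filterT.
  have : filter_prod (nbhs z) 0^'+ [set p | quotient f v p.1 p.2 < clarke_dir z v + e
    / 2 /\
      A (p.1 + p.2 *: v) /\ B p.2 /\ 0 < p.2].
    apply: filterI Cv _; apply: filterI nA' _; apply: filterI nB' _.
    exact: near_prod_right_gt0.
  apply: filterS => -[z' t] /= [h1 [h2 [h3 t0]]].
  have := AB (z' + t *: v, t) (conj h2 h3); move: h1; rewrite /quotient /=.
  rewrite scalerDr [t *: u + _]addrC addrA; set a := f (z' + _ + _); set b := f _;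
    set c := f _.
  rewrite !ltr_pdivrMr// ler_pdivrMr// => h1 h4; lra.
rewrite le_eqVlt => /predU1P[<-|a0].
  rewrite scale0r mul0r; apply/eqP; rewrite eq_le; apply/andP; split.
    apply: clarke_dir_le; apply: filterS (near_prod_right_gt0 z) => -[z' t] /= _.
    by rewrite /quotient scaler0 addr0 subrr mul0r.
  apply: clarke_dir_ge; apply: nearW => t.
  by rewrite /quotient scaler0 addr0 subrr mul0r.
apply/eqP; rewrite eq_le pZ//= -ler_pdivlMl//.
rewrite -{1}(scale1r u) -(mulVf (lt0r_neq0 a0)) -scalerA.
by rewrite pZ// invr_gt0.
Qed.

Lemma clarke_nonempty z : clarke f z !=set0.
Proof.
have [eta H] := sublinear_dominates (clarke_dir_sublinear z).
by exists eta; apply/clarkeP.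
Qed.

End lipschitz.

Lemma enorm_sqr (u : 'rV[R]_d) : enorm u ^+ 2 = dotv u u.
Proof. by rewrite /enorm sqr_sqrtr// sumr_ge0// => i _; rewrite -expr2 sqr_ge0. Qed.

(* The slopes of the concave function f - rho/2 |.|^2 decrease along a line. *)
Lemma weakly_concave_quotient f (rho : R) Omega z w (s t : R) :
  weakly_concave rho Omega f -> Omega (z + t *: w) -> Omega (z - s *: w) ->
  0 < s -> 0 < t ->
  quotient f w z t <= quotient f w (z - s *: w) s + rho / 2 * (s + t) * dotv w w.
Proof.
move=> [_ cf] Ot Os s0 t0; have st0 : 0 < s + t by rewrite addr_gt0.
have a0 : 0 <= s / (s + t) by rewrite divr_ge0// ltW.
have a1 : s / (s + t) <= 1 by rewrite ler_pdivrMr// mul1r lerDl ltW.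
have := convex_functionE cf Ot Os a0 a1.
have -> : (s / (s + t)) *: (z + t *: w) + (1 - s / (s + t)) *: (z - s *: w) = z.
  by apply/rowP => i; rewrite !mxE; field; rewrite gt_eqF.
have -> : 1 - s / (s + t) = t / (s + t) by field; rewrite gt_eqF.
rewrite !enorm_sqr.
have -> : dotv (z + t *: w) (z + t *: w) = dotv z z + 2 * t * dotv z w + t ^+ 2 * dotv
  w w.
  by rewrite !(dotvDl, dotvDr, dotvZl, dotvZr) [dotv w z]dotvC; ring.
have -> : dotv (z - s *: w) (z - s *: w) = dotv z z - 2 * s * dotv z w + s ^+ 2 * dotv
  w w.
  by rewrite !(dotvDl, dotvDr, dotvNl, dotvNr, dotvZl, dotvZr) [dotv w z]dotvC; ring.
rewrite /quotient subrK => H.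
rewrite -subr_ge0; set D := (X in 0 <= X).
(* [D] is the convexity gap at [z], as a combination of [z + t *: w] and [z - s *: w], rescaled by a
   positive factor. *)
have -> : D = (s + t) / (s * t) * ((s / (s + t) *
     (- f (z + t *: w) + rho / 2 * (dotv z z + 2 * t * dotv z w + t ^+ 2 * dotv w w)) +
     t / (s + t) *
     (- f (z - s *: w) + rho / 2 * (dotv z z - 2 * s * dotv z w + s ^+ 2 * dotv w w))) -
     (- f z + rho / 2 * dotv z z)).
  by rewrite /D; field; rewrite !gt_eqF.
by rewrite mulr_ge0 ?subr_ge0// divr_ge0 ?mulr_ge0// ltW.
Qed.

Lemma convex_quotient_le f z w (s t : R) :
  convex_function (setT : set (convex_lmodType 'rV[R]_d)) f ->
  0 < t -> t <= s -> quotient f w z t <= quotient f w z s.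
Proof.
move=> cf t0 ts; have s0 : 0 < s by exact: lt_le_trans ts.
have a0 : 0 <= t / s by rewrite divr_ge0// ltW.
have a1 : t / s <= 1 by rewrite ler_pdivrMr// mul1r.
have := @convex_functionE _ _ _ _ (z + s *: w) z _ cf I I a0 a1.
have -> : (t / s) *: (z + s *: w) + (1 - t / s) *: z = z + t *: w.
  by apply/rowP => i; rewrite !mxE; field; rewrite gt_eqF.
move=> H; rewrite /quotient ler_pdivrMr// mulrAC -mulrA.
by move: H; rewrite !mulrBl mul1r ![_ * (t / s)]mulrC; lra.
Qed.

(** Slopes increase with the step, so each quotient with [t < 1] is at most the one with step 1 at
    the same [z']; the Lipschitz bound returns from [z'] to [z] at a cost of [e / 2] for each of the
    two values. *)
Lemma convex_clarke_dir_le f (L : R) z w : 0 < L ->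
  lipschitz_with L f ->
  convex_function (setT : set (convex_lmodType 'rV[R]_d)) f ->
  clarke_dir f z w <= f (z + w) - f z.
Proof.
move=> L0 Lf cf; apply/ler_addgt0Pr => e e0.
have r0 : 0 < e / 2 / L by rewrite !divr_gt0.
apply: (clarke_dir_le Lf).
exists ([set z' | `|z - z'| < e / 2 / L], [set t | 0 < t /\ t < 1]) => /=.
  split; first exact: (near_norm_lt z r0).
  by apply: filterI; [exact: nbhs_right_gt|exact: nbhs_right_lt].
move=> [z' t] /= [zz [t0 t1]].
apply: (le_trans (convex_quotient_le _ _ cf t0 (ltW t1))).
rewrite /quotient scale1r divr1.
have H : L * `|z - z'| <= e / 2 by rewrite -ler_pdivlMl// mulrC ltW.
have := Lf (z' + w) (z + w); have := Lf z z'.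
rewrite (_ : z' + w - (z + w) = - (z - z')) ?normrN; last by apply/rowP => i;
  rewrite !mxE; ring.
by rewrite !ler_norml => /andP[h1 h2] /andP[h3 h4]; lra.
Qed.

(** Nonemptiness matters: [inf] of the empty set is 0 by convention, so a small [dist] would then
    provide no point. *)
Lemma dist_lt_ex (z : 'rV[R]_d) (A : set 'rV[R]_d) (e : R) :
  A !=set0 -> dist z A < e -> exists2 a, A a & enorm (a - z) < e.
Proof.
move=> [a Aa] /inf_lt[|_ [b Ab <-] be]; last by exists b.
by exists (enorm (a - z)), a.
Qed.

End clarke_theory.
(** * The value function and its entropic approximation *)

Section value_theory.
Variables (R : realType) (n m : nat) (L : R).
Variables (g : 'rV[R]_(n + m) -> R) (Y : set 'rV[R]_m).
Hypotheses (L0 : 0 < L) (Lg : lipschitz_with L g) (Y0 : Y !=set0) (cY : closed Y).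
Hypothesis lbg : level_bounded g.

Lemma lipschitz_row_mx x x' y y' :
  g (row_mx x' y') <= g (row_mx x y) + L * (`|x' - x| + `|y' - y|).
Proof.
rewrite -lerBlDl (le_trans (ler_norm _))// (le_trans (Lg _ _))// ler_pM2l//.
by rewrite opp_row_mx add_row_mx norm_row_mx.
Qed.

Lemma lipschitz_with_slicel y : lipschitz_with L (fun x => g (row_mx x y)).
Proof.
move=> x x'; rewrite (le_trans (Lg _ _))// ler_pM2l//.
by rewrite opp_row_mx add_row_mx subrr (le_trans (norm_row_mx _ _))// normr0 addr0.
Qed.

Lemma lipschitz_with_slicer x : lipschitz_with L (fun y => g (row_mx x y)).
Proof.
move=> y y'; rewrite (le_trans (Lg _ _))// ler_pM2l//.
by rewrite opp_row_mx add_row_mx subrr (le_trans (norm_row_mx _ _))// normr0 add0r.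
Qed.

Lemma enorm0 : enorm (0 : 'rV[R]_n) = 0.
Proof. by rewrite /enorm dotv0r sqrtr0. Qed.

Lemma level_bounded_slice x (M : R) :
  exists B : R, forall y, g (row_mx x y) <= M -> `|row_mx x y| <= B.
Proof.
have [r r0 [B [_ HB]]] := lbg x M; exists (B + 1) => y gM.
by apply: (HB (B + 1)); rewrite ?ltrDl//=; rewrite row_mxKl subrr enorm0.
Qed.

(** Where [g (row_mx x y) <= 0], level-boundedness confines [row_mx x y] to a ball, and there the
    Lipschitz bound from the origin keeps [g] bounded below. *)
Lemma value_has_inf x : has_inf [set g (row_mx x y) | y in Y].
Proof.
split; first by have [y Yy] := Y0; exists (g (row_mx x y)), y.
have [B HB] := level_bounded_slice x 0.
exists (Num.min 0 (g 0 - L * B)) => _ [y Yy <-].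
have [g0|g0] := leP (g (row_mx x y)) 0; last by rewrite ge_min ltW.
rewrite ge_min; apply/orP; right; rewrite lerBlDr -lerBlDl.
rewrite (le_trans (ler_norm _))// (le_trans (Lg _ _))// ler_pM2l// sub0r normrN.
exact: HB.
Qed.

Lemma value_le x y : Y y -> value g Y x <= g (row_mx x y).
Proof. by move=> Yy; apply: ge_inf; [exact: (value_has_inf x).2|exists y]. Qed.

Lemma value_ge x (c : R) : (forall y, Y y -> c <= g (row_mx x y)) -> c <= value g Y x.
Proof.
move=> H; apply: lb_le_inf; first exact: (value_has_inf x).1.
by move=> _ [y Yy <-]; exact: H.
Qed.

Lemma value_adherent x (e : R) : 0 < e ->
  exists2 y, Y y & g (row_mx x y) < value g Y x + e.
Proof.
by move=> e0; have [_ [y Yy <-] H] := inf_adherent e0 (value_has_inf x); exists y.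
Qed.

Lemma value_lipschitz : lipschitz_with L (value g Y).
Proof.
have H u v : value g Y u - value g Y v <= L * `|u - v|.
  rewrite lerBlDl -lerBlDr; apply: value_ge => y Yy; rewrite lerBlDr.
  apply: le_trans (value_le u Yy) _.
  by have := lipschitz_row_mx v u y y; rewrite subrr normr0 addr0.
by move=> u v; rewrite ler_norml H andbT lerNl opprB distrC H.
Qed.

Lemma argminP x y : argmin g Y x y <-> Y y /\ g (row_mx x y) <= value g Y x.
Proof.
split=> -[Yy H]; split=> //; first by apply: value_ge.
by move=> y' Yy'; exact: le_trans H (value_le _ _).
Qed.

Lemma sublevel_compact x (M : R) : compact [set y | Y y /\ g (row_mx x y) <= M].
Proof.
apply: bounded_closed_compact.
  have [B HB] := level_bounded_slice x M.
  exists B; split; first exact: num_real.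
  by move=> c Bc y [_ /HB H] /=; rewrite (le_trans (norm_row_mxr x y))// (le_trans
    H)// ltW.
apply: closedI => //.
have cg : continuous (fun y => g (row_mx x y)).
  move=> y; apply/(@cvgrPdist_le _ _ _ (nbhs y)) => e e0.
  apply: filterS (near_norm_lt y (divr_gt0 e0 L0)) => y' yy'.
  rewrite (le_trans (lipschitz_with_slicer _ _ _))// -ler_pdivlMl// mulrC.
  exact: ltW.
have := @preimage_closed _ _ (fun y => g (row_mx x y)) [set r | r <= M].
by apply => [y _|]; [exact: cg|exact: closed_le].
Qed.

End value_theory.

(** * The entropic value and its gradient for a fixed positive [mu] *)

Section entropic_value.
Variables (R : realType) (n m : nat).
Variables (OX : set 'rV[R]_n) (OY : set 'rV[R]_m).
Variables (g_ : R -> 'rV[R]_(n + m) -> R) (Y_ : R -> set 'rV[R]_m) (mu : R).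
Hypotheses (oOX : open OX) (oOY : open OY) (mu0 : 0 < mu).
Hypotheses (cK : compact (Y_ mu)) (KOY : Y_ mu `<=` OY) (K0 : (0 < vol (Y_ mu))%E).
Hypothesis dg : continuously_differentiable (setX_rV OX OY) (g_ mu).
Local Notation K := (Y_ mu).
Local Notation lam := (lebesgue_rV R m).

Let phi z : R := expR (- mu^-1 * g_ mu z).

Let derivative_rescaled_expR (t : R) :
  is_derive t 1 (fun t => expR (- mu^-1 * t)) (- mu^-1 * expR (- mu^-1 * t)).
Proof.
have h : is_derive t 1 (fun t : R => - mu^-1 * t) (- mu^-1).
  have -> : (fun t : R => - mu^-1 * t) = - mu^-1 *: id by [].
  by rewrite -[X in is_derive _ _ _ X]mulr1; exact: is_deriveZ.
have h2 : is_derive (- mu^-1 * t) 1 expR (expR (- mu^-1 * t)) by exact: is_derive_expR.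
by apply: (is_derive_eq (is_derive1_comp h2 h)); rewrite mulrC.
Qed.

Let derive1_rescaled_expR :
  derive1 (fun t : R => expR (- mu^-1 * t)) = fun t => - mu^-1 * expR (- mu^-1 * t).
Proof.
by apply/funext => t; rewrite derive1E; have [] := derivative_rescaled_expR t.
Qed.

Lemma rescaled_expR_C1 : continuously_differentiable (setX_rV OX OY) phi.
Proof.
apply: (continuously_differentiable_comp (g := fun t => expR (- mu^-1 * t))) => //.
  exact: open_setX_rV.
move=> z _; split; first by have [] := derivative_rescaled_expR (g_ mu z).
rewrite derive1_rescaled_expR => t.
apply: cvgM; first exact: cvg_cst.
apply: (@continuous_comp _ _ _ (fun t => - mu^-1 * t) expR);
  last exact: continuous_expR.
by apply: cvgM; [exact: cvg_cst|exact: cvg_id].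
Qed.

Let cphi z : setX_rV OX OY z -> {for z, continuous phi}.
Proof.
by move=> Oz; apply: differentiable_continuous; exact: rescaled_expR_C1.1.
Qed.

Lemma integrable_rescaled_expR x : OX x ->
  lam.-integrable K (EFin \o (fun y => phi (row_mx x y))).
Proof. by move=> Ox; exact: (integrable_slice oOY cK KOY cphi). Qed.

Let volK_gt0 : 0 < fine (vol K).
Proof. by rewrite fine_gt0// K0/=; exact: compact_finite_lebesgue_rV. Qed.

Lemma gibbs_mass_le x (c : R) : OX x -> (forall y, K y -> c <= g_ mu (row_mx x y)) ->
  gibbs_mass g_ Y_ mu x <= expR (- mu^-1 * c) * fine (vol K).
Proof.
move=> Ox H; apply: Rintegral_le_cst => //; first exact: integrable_rescaled_expR.
by move=> y Ky; rewrite ler_expR ler_wnM2l ?H// oppr_le0 invr_ge0 ltW.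
Qed.

Lemma gibbs_mass_ge x (c : R) (A : set 'rV[R]_m) : OX x ->
  measurable (A : set (borel_rV R m)) -> A `<=` K ->
  (forall y, A y -> g_ mu (row_mx x y) <= c) ->
  expR (- mu^-1 * c) * fine (vol A) <= gibbs_mass g_ Y_ mu x.
Proof.
move=> Ox mA AK H; have mK := compact_measurable_rV cK.
have Iphi := integrable_rescaled_expR Ox.
have IA := integrableS mK mA AK Iphi.
have Afin : (lam A < +oo)%E.
  apply: le_lt_trans (compact_finite_lebesgue_rV cK).
  by apply: le_measure; rewrite ?inE.
apply: (@le_trans _ _ (\int[lam]_(y in A) phi (row_mx x y))).
  rewrite -Rintegral_cst//; apply: le_Rintegral => //.
    apply: measurable_bounded_integrable => //.
    exact: bounded_cst.
  by move=> y Ay; rewrite ler_expR ler_wnM2l ?H// oppr_le0 invr_ge0 ltW.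
rewrite fine_le//; [exact: integrable_fin_num IA|exact: integrable_fin_num Iphi|].
apply: ge0_subset_integral => //; first by case/integrableP : Iphi.
by move=> y _; rewrite lee_fin expR_ge0.
Qed.

Lemma gibbs_mass_gt0 x : OX x -> 0 < gibbs_mass g_ Y_ mu x.
Proof.
move=> Ox; have mK := compact_measurable_rV cK.
have cg : {in OY, continuous (fun y => g_ mu (row_mx x y))}.
  apply: (@continuous_slice _ _ _ OX) => // z Oz.
  by apply: differentiable_continuous; exact: dg.1.
have cgK : {within K, continuous (fun y => g_ mu (row_mx x y))}.
  apply: continuous_in_subspaceT => y /set_mem Ky.
  by apply: cg; exact/mem_set/KOY.
have /compact_bounded[M [_ HM]] := continuous_compact cgK cK.
apply: (@lt_le_trans _ _ (expR (- mu^-1 * (M + 1)) * fine (vol K))).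
  by rewrite mulr_gt0// expR_gt0.
apply: gibbs_mass_ge => // y Ky; rewrite (le_trans (ler_norm _))//.
by apply: HM; [rewrite ltrDl|exists y].
Qed.

Let derivative_rescaled_ln (t : R) : 0 < t ->
  is_derive t 1 (fun t => - mu * ln t) (- mu * t^-1).
Proof.
move=> t0; have -> : (fun t : R => - mu * ln t) = - mu *: (@ln R) by [].
by apply: is_deriveZ; exact: is_derive1_ln.
Qed.

Lemma v_ent_C1 : continuously_differentiable OX (v_ent g_ Y_ mu).
Proof.
apply: (continuously_differentiable_comp (g := fun t => - mu * ln t)) => //.
  exact: (continuously_differentiable_integral oOX oOY cK KOY rescaled_expR_C1).
move=> x Ox; have F0 := gibbs_mass_gt0 Ox; set t := gibbs_mass _ _ _ _ in F0 *.
split; first by have [] := derivative_rescaled_ln F0.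
have E : forall s : R, 0 < s -> derive1 (fun t => - mu * ln t) s = - mu * s^-1.
  by move=> s s0; rewrite derive1E; have [] := derivative_rescaled_ln s0.
rewrite /prop_for /continuous_at E//.
apply: (@cvg_near_eq _ _ t _ (fun s => - mu * s^-1)).
  have : \forall s \near t, 0 < s by exact: lt_nbhsr.
  by apply: filterS => s; exact: E.
by apply: cvgM; [exact: cvg_cst|apply: cvgV; [exact: lt0r_neq0|exact: cvg_id]].
Qed.

Lemma dotv_grad_v_ent x (w : 'rV[R]_n) : OX x ->
  lam.-integrable K (EFin \o (fun y => alpha g_ Y_ mu x y * dotv (gradx (g_ mu) x y)
    w)) /\
  dotv (grad (v_ent g_ Y_ mu) x) w =
    \int[lam]_(y in K) (alpha g_ Y_ mu x y * dotv (gradx (g_ mu) x y) w).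
Proof.
move=> Ox; have mK := compact_measurable_rV cK; have F0 := gibbs_mass_gt0 Ox.
have [dF gF] := differentiable_integral oOX oOY cK KOY rescaled_expR_C1 Ox.
have [I1 I2] := integrable_dotv_gradx oOX oOY cK KOY rescaled_expR_C1 w Ox.
pose F := gibbs_mass g_ Y_ mu x.
(* [- mu / F] is the derivative of [- mu * ln] at the mass [F]; its [- mu] cancels the [- mu^-1]
   coming from the exponential. *)
have E y : K y -> - mu / F * dotv (gradx phi x y) w =
    alpha g_ Y_ mu x y * dotv (gradx (g_ mu) x y) w.
  move=> Ky; have [dgx _] := partial_gradient (dg.1 _ (setX_rV_row_mx Ox (KOY Ky))).
  have [|_] := grad_comp (g := fun t => expR (- mu^-1 * t)) dgx.
    by have [] := derivative_rescaled_expR (g_ mu (row_mx x y)).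
  rewrite derive1_rescaled_expR => Eg.
  rewrite /gradx [grad (fun x' => phi (row_mx x' y)) x]Eg dotvZl /alpha -/F.
  by field; rewrite !gt_eqF.
have := integrableZl mK (- mu / F) I1 => I1'.
have I3 : lam.-integrable K (EFin \o (fun y =>
  alpha g_ Y_ mu x y * dotv (gradx (g_ mu) x y) w)).
  apply: eq_integrable I1' => // y /set_mem Ky /=.
  by rewrite -EFinM E.
split=> //.
have -> : \int[lam]_(y in K) (alpha g_ Y_ mu x y * dotv (gradx (g_ mu) x y) w) =
    \int[lam]_(y in K) (- mu / F * dotv (gradx phi x y) w).
  by apply: eq_Rintegral => y /set_mem Ky; rewrite E.
rewrite RintegralZl// I2 -gF.
have [|_ ->] := grad_comp (g := fun t => - mu * ln t) dF.
  by have [] := derivative_rescaled_ln F0.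
by rewrite dotvZl derive1E; have [_ ->] := derivative_rescaled_ln F0.
Qed.

Lemma integral_alpha x : OX x ->
  lam.-integrable K (EFin \o alpha g_ Y_ mu x) /\
  \int[lam]_(y in K) alpha g_ Y_ mu x y = 1.
Proof.
move=> Ox; have mK := compact_measurable_rV cK; have F0 := gibbs_mass_gt0 Ox.
have Iphi := integrable_rescaled_expR Ox.
split.
  apply: eq_integrable (integrableZr mK (gibbs_mass g_ Y_ mu x)^-1 Iphi) => // y _ /=.
rewrite /alpha RintegralZr// -/(gibbs_mass _ _ _ _).
by rewrite divff// gt_eqF.
Qed.

Lemma v_ent_ge x (c : R) : OX x -> (forall y, K y -> c <= g_ mu (row_mx x y)) ->
  c - mu * ln (fine (vol K)) <= v_ent g_ Y_ mu x.
Proof.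
move=> Ox H; have F0 := gibbs_mass_gt0 Ox.
have := gibbs_mass_le Ox H.
rewrite -ler_ln ?posrE ?mulr_gt0 ?expR_gt0// lnM ?posrE ?expR_gt0// expRK => h.
rewrite /v_ent mulNr lerNr opprB (le_trans (ler_wpM2l (ltW mu0) h))//.
by rewrite mulrDr mulrA mulrN divff ?gt_eqF// mulN1r addrC.
Qed.

(** A single piece [A] of the domain bounds the mass from below; what remains of it is the term
    [mu * ln (fine (vol A))], which vanishes with [mu] when [A] is fixed. *)
Lemma v_ent_le x (c : R) (A : set 'rV[R]_m) : OX x ->
  measurable (A : set (borel_rV R m)) -> A `<=` K -> 0 < fine (vol A) ->
  (forall y, A y -> g_ mu (row_mx x y) <= c) ->
  v_ent g_ Y_ mu x <= c - mu * ln (fine (vol A)).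
Proof.
move=> Ox mA AK A0 H; have F0 := gibbs_mass_gt0 Ox.
have := gibbs_mass_ge Ox mA AK H.
rewrite -ler_ln ?posrE ?mulr_gt0 ?expR_gt0// lnM ?posrE ?expR_gt0// expRK => h.
rewrite /v_ent mulNr lerNl opprB (le_trans _ (ler_wpM2l (ltW mu0) h))//.
by rewrite mulrDr mulrA mulrN divff ?gt_eqF// mulN1r addrC.
Qed.

End entropic_value.
(** * Gradient consistency *)

Section entropic_limit.
Variables (R : realType) (n m : nat) (L : R).
Variables (OX : set 'rV[R]_n) (OY Y : set 'rV[R]_m).
Variables (g : 'rV[R]_(n + m) -> R) (g_ : R -> 'rV[R]_(n + m) -> R).
Variable Y_ : R -> set 'rV[R]_m.
Hypotheses (oOX : open OX) (oOY : open OY) (YOY : Y `<=` OY).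
Hypotheses (L0 : 0 < L) (Lg : lipschitz_with L g) (lbg : level_bounded g).
Hypotheses (Y0 : Y !=set0) (cY : closed Y)
  (convY : convex_set (Y : set (convex_lmodType 'rV[R]_m))).
Hypothesis dg : forall mu, 0 < mu -> continuously_differentiable (setX_rV OX OY) (g_
  mu).
Hypothesis cK : forall mu, 0 < mu -> compact (Y_ mu).
Hypothesis KY : forall mu, 0 < mu -> Y_ mu `<=` Y.
Hypothesis K0 : forall mu, 0 < mu -> (0 < vol (Y_ mu))%E.
Hypothesis Yincr : increases_to Y_ Y.
Hypothesis g_unif : forall Omega' : set 'rV[R]_n, open Omega' ->
  closure Omega' `<=` OX ->
    forall e : R, 0 < e -> \forall mu \near 0^'+,
      forall x y, closure Omega' x -> Y y ->
        `|g_ mu (row_mx x y) - g (row_mx x y)| < e.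
Hypothesis vol_small : mu * ln (fine (vol (Y_ mu))) @[mu --> 0^'+] --> (0 : R).

Local Notation v := (value g Y).
Local Notation v_ := (v_ent g_ Y_).

Let KOY mu : 0 < mu -> Y_ mu `<=` OY.
Proof. by move=> mu0; apply: subset_trans (KY mu0) YOY. Qed.

(** Uniform convergence is available only on sets with closure inside [OX]; a ball of half the
    admissible radius is one. *)
Lemma near_approx x (e : R) : OX x -> 0 < e -> \forall x' \near x & mu \near 0^'+,
  OX x' /\ forall y, Y y -> `|g_ mu (row_mx x' y) - g (row_mx x' y)| < e.
Proof.
move=> Ox e0.
have /nbhs_ballP[r /= r0 rOX] : nbhs x OX by exact: open_nbhs_nbhs.
have r2 : 0 < r / 2 by rewrite divr_gt0.
have cB : closure (ball x (r / 2)) `<=` OX.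
  move=> z zB; apply: rOX.
  have [w [xw zw]] := zB (ball z (r / 2)) (nbhsx_ballx _ _ r2).
  by apply: ball_split xw _; exact: ball_sym.
have oB : open (ball x (r / 2)) by exact: ball_open.
have := g_unif oB cB e0.
move=> /(filter_prod2 (F := nbhs x)) H1.
have : \forall x' \near x, ball x (r / 2) x' by exact: nbhsx_ballx.
move=> /(filter_prod1 (G := (0 : R)^'+)) H2.
have : filter_prod (nbhs x) 0^'+ [set p | ball x (r / 2) p.1 /\
    forall x' y, closure (ball x (r / 2)) x' -> Y y ->
        `|g_ p.2 (row_mx x' y) - g (row_mx x' y)| < e] by exact: filterI H2 H1.
apply: filterS => -[x' mu] /= [Bx' H]; split.
  by apply: cB; exact: subset_closure.
by move=> y Yy; apply: H => //; exact: subset_closure.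
Qed.

(** [Y] is the union of the countably many [Y_ (s k)]; if all of their traces on the ball were null,
    so would be that of [Y]. *)
Lemma lebesgue_ball_gt0 y (r : R) : Y y -> 0 < r ->
  exists2 mu, 0 < mu & 0 < fine (vol (Y_ mu `&` ball y r)).
Proof.
move=> Yy r0; apply: contrapT => H.
have mB mu : 0 < mu -> measurable (Y_ mu `&` ball y r : set (borel_rV R m)).
  move=> mu0; apply: measurableI; first exact: compact_measurable_rV (cK mu0).
  by apply: open_measurable_rV; exact: ball_open.
have V0 mu : 0 < mu -> vol (Y_ mu `&` ball y r) = 0%E.
  move=> mu0; apply/eqP; apply: contrapT => /negP V0; apply: H; exists mu => //.
  rewrite fine_gt0// lt0e V0 measure_ge0/=.
  apply: le_lt_trans (compact_finite_lebesgue_rV (cK mu0)).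
  by apply: le_measure; rewrite ?inE//; [exact: mB|exact:
    compact_measurable_rV (cK mu0)].
have := convex_ball_lebesgue_gt0 cY convY (cK ltr01) (KY ltr01) (K0 ltr01) Yy r0.
suff -> : lebesgue_rV R m (Y `&` ball y r) = 0%E by rewrite ltxx.
apply: measure_negligible.
  apply: measurableI; first exact: closed_measurable_rV.
  by apply: open_measurable_rV; exact: ball_open.
pose s (k : nat) : R := k.+1%:R^-1.
have s0 k : 0 < s k by rewrite invr_gt0.
apply: (@negligibleS _ _ _ (lebesgue_rV R m) (\bigcup_k (Y_ (s k) `&` ball y r)));
  last first.
  apply: negligible_bigcup => k; exists (Y_ (s k) `&` ball y r).
  by split; [exact: mB|exact: V0|].
move=> z [Yz Bz].
have : (\bigcup_(mu in [set mu | 0 < mu]) Y_ mu) z by rewrite Yincr.2.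
(* Monotonicity needs a strictly smaller index: [s k < mu] holds for [k] the integer part of
   [mu^-1]. *)
move=> [mu /= mu0 Kz]; exists (Num.truncn mu^-1) => //; split=> //.
have smu : s (Num.truncn mu^-1) < mu.
  rewrite /s invf_plt ?posrE//; apply: truncnS_gt.
exact: (Yincr.1 _ _ (s0 _) smu).1.
Qed.

Lemma v_ent_cvg x : OX x ->
  v_ p.2 p.1 @[p --> filter_prod (nbhs x) 0^'+] --> v x.
Proof.
move=> Ox; apply/(@cvgrPdist_le _ _ _ (filter_prod (nbhs x) 0^'+)) => e e0.
(* The upper bound costs five: one for the near-minimizer [y], two for moving from [(x, y)] to
   [(x', z)], one for replacing [g] by [g_ mu], one for the volume of [A]. *)
pose e' := e / 5; have e'0 : 0 < e' by rewrite divr_gt0.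
have r0 : 0 < e' / L by rewrite divr_gt0.
have Lr : L * (e' / L) = e' by field; rewrite gt_eqF.
have [y Yy gy] := value_adherent L0 Lg Y0 lbg x e'0.
have [nu nu0 V0] := lebesgue_ball_gt0 Yy r0.
set A := Y_ nu `&` ball y (e' / L) in V0.
have mA : measurable (A : set (borel_rV R m)).
  apply: measurableI; first exact: compact_measurable_rV (cK nu0).
  by apply: open_measurable_rV; exact: ball_open.
have C1 := near_approx Ox e'0.
have C2 : \forall x' \near x & mu \near (0 : R)^'+, `|x - x'| < e' / L.
  exact: (filter_prod1 (near_norm_lt x r0)).
have C3 := filter_prod2 (F := nbhs x) (nbhs_right_gt (0 : R)).
have C4 := filter_prod2 (F := nbhs x) (nbhs_right_lt nu0).
have C5 : \forall mu \near 0^'+, `|mu * ln (fine (vol (Y_ mu)))| < e'.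
  have /cvgrPdist_lt/(_ _ e'0) := vol_small.
  by apply: filterS => mu; rewrite sub0r normrN.
have C6 : \forall mu \near 0^'+, `|mu * ln (fine (vol A))| < e'.
  pose c := `|ln (fine (vol A))| + 1.
  have c0 : 0 < c by rewrite ltr_wpDl.
  near=> mu; have mu0 : 0 < mu by near: mu; exact: nbhs_right_gt.
  rewrite normrM gtr0_norm//; apply: (@le_lt_trans _ _ (mu * c)).
    by rewrite ler_pM2l// lerDl.
  by rewrite -ltr_pdivlMr//; near: mu; apply: nbhs_right_lt; rewrite divr_gt0.
move: C5 C6 => /(filter_prod2 (F := nbhs x)) C5 /(filter_prod2 (F := nbhs x)) C6.
have : filter_prod (nbhs x) 0^'+ [set p | ((OX p.1 /\ forall y, Y y ->
    `|g_ p.2 (row_mx p.1 y) - g (row_mx p.1 y)| < e') /\ `|x - p.1| < e' / L) /\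
  ((0 < p.2 /\ p.2 < nu) /\ `|p.2 * ln (fine (vol (Y_ p.2)))| < e' /\
   `|p.2 * ln (fine (vol A))| < e')].
  apply: filterI; first exact: filterI C1 C2.
  by apply: filterI; [exact: filterI (C3 _) (C4 _)|exact: filterI C5 C6].
apply: filterS => -[x' mu] /= [[[Ox' H1] H2] [[mu0 munu] [H5 H6]]].
have AK : A `<=` Y_ mu by move=> z [Kz _]; exact: (Yincr.1 _ _ mu0 munu).1.
have vx' := value_lipschitz L0 Lg Y0 lbg x x'.
have {}vx' : `|v x - v x'| <= e'.
  by apply: le_trans vx' _; rewrite -Lr ler_pM2l// ltW.
have lower : v x' - e' - mu * ln (fine (vol (Y_ mu))) <= v_ mu x'.
  apply: (v_ent_ge (OX := OX) (OY := OY)) => //;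
    [exact: cK|exact: KOY|exact: K0|exact: dg|].
  move=> z Kz; have Yz := KY mu0 Kz.
  have := value_le L0 Lg Y0 lbg x' Yz; have := H1 z Yz.
  by rewrite ltr_norml => /andP[h1 h2] h3; lra.
have upper : v_ mu x' <= v x + 4 * e' - mu * ln (fine (vol A)).
  apply: (v_ent_le (OX := OX) (OY := OY)) => //;
    [exact: cK|exact: KOY|exact: K0|exact: dg|].
  move=> z Az; have Yz := KY mu0 (AK z Az).
  have := lipschitz_row_mx L0 Lg x x' y z; have := H1 z Yz.
  rewrite ltr_norml => /andP[h1 h2].
  have zy : `|z - y| < e' / L by case: Az => _; rewrite -ball_normE /ball_/= distrC.
  have : L * (`|x' - x| + `|z - y|) <= L * (e' / L + e' / L).
    by rewrite ler_pM2l// lerD// ltW// distrC.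
  by rewrite [L * (e' / L + _)]mulrDr Lr => h3 h4; lra.
move: H5 H6 vx'; rewrite !ltr_norml !ler_norml =>
  /andP[a1 a2] /andP[a3 a4] /andP[a5 a6].
have ee : e = 5 * e' by rewrite /e'; field.
by rewrite ee; apply/andP; split; lra.
Unshelve. all: by end_near. Qed.

Lemma v_ent_smooth_approximations : smooth_approximations v_ v OX.
Proof.
split; first exact: oOX.
- move=> x Ox; apply/(@cvgrPdist_le _ _ _ (nbhs x)) => e e0.
  apply: filterS (near_norm_lt x (divr_gt0 e0 L0)) => x' xx'.
  rewrite (le_trans (value_lipschitz L0 Lg Y0 lbg _ _))// -ler_pdivlMl// mulrC.
  exact: ltW.
- move=> mu mu0; apply: (v_ent_C1 oOX oOY mu0);
    [exact: cK|exact: KOY|exact: K0|exact: dg].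
- exact: v_ent_cvg.
Qed.

Variable xbar : 'rV[R]_n.
Hypothesis xbar_OX : OX xbar.
Hypothesis gradx_near : forall e : R, 0 < e -> \forall x \near xbar & mu \near 0^'+,
  forall y, Y y -> dist (gradx (g_ mu) x y) (clarkex g x y) < e.

Let slice y := fun x => g (row_mx x y).

(** By condition (3), some Clarke subgradient of the slice is close to the gradient; dividing the
    tolerance by [l1norm d + 1] makes the pairing with [d] cost at most [e]. *)
Lemma gradx_le_clarke (d : 'rV[R]_n) (e : R) : 0 < e ->
  \forall x \near xbar & mu \near 0^'+, forall y, Y y ->
    dotv (gradx (g_ mu) x y) d <= clarke_dir (slice y) x d + e.
Proof.
move=> e0; have l0 : 0 < l1norm d + 1 by rewrite ltr_wpDl// l1norm_ge0.
apply: filterS (gradx_near (divr_gt0 e0 l0)) => -[x mu] /= H y Yy.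
have Ly := lipschitz_with_slicel L0 Lg y.
have [xi /(clarkeP Ly) xic xie] := dist_lt_ex (clarke_nonempty Ly x) (H y Yy).
rewrite -[gradx _ _ _](subrK xi) dotvDl addrC lerD//.
apply: (le_trans (ler_norm _)); apply: (le_trans (dotv_le_l1 _ _)).
apply: (@le_trans _ _ (e / (l1norm d + 1) * l1norm d)).
  rewrite ler_wpM2r ?l1norm_ge0// distrC (le_trans (rV_norm_enorm _))//.
  exact: ltW.
by rewrite mulrAC ler_pdivrMr// ler_pM2l// lerDl.
Qed.

(* Compactness of a sublevel set of g(xbar, .) makes the local dichotomy uniform in y. *)
Lemma argmin_gap (d : 'rV[R]_n) (c e : R) :
  (forall ybar, argmin g Y xbar ybar ->
    \forall y \near ybar & p \near filter_prod (nbhs xbar) (0 : R)^'+,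
      Y y -> quotient (slice y) d p.1 p.2 <= c + e) ->
  exists2 delta : R, 0 < delta & \forall x \near xbar, forall y, Y y ->
    clarke_dir (slice y) x d <= c + e \/ v xbar + delta <= g (row_mx xbar y).
Proof.
move=> H.
(* The gap enters as a parameter tending to 0 from the right alongside [x], so that the covering
   argument selects a common gap together with a common neighborhood of [xbar]. *)
pose P (q : R * 'rV[R]_n) y :=
  clarke_dir (slice y) q.2 d <= c + e \/ v xbar + q.1 <= g (row_mx xbar y).
have /compact_near_coveringP/near_covering_withinP cS :=
  @sublevel_compact _ _ _ _ _ _ L0 Lg cY lbg xbar (v xbar + 1).
have [] := cS _ (filter_prod (0 : R)^'+ (nbhs xbar)) P.
  move=> ybar [Yybar gybar].
  have [vg|vg] := leP (g (row_mx xbar ybar)) (v xbar).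
    have [|[A Q] /= [nA [[B T] /= [nB nT] BT]] AQ] := H ybar.
      by apply/(argminP L0 Lg Y0 lbg).
    (* The Clarke derivative at [x] involves quotients at all points near [x], so [x] has to be
       interior to the set where they are bounded. *)
    exists (A, setT `*` interior B) => /=.
      split=> //; exists (setT, interior B) => //=.
      by split; [exact: filterT|exact: nbhs_interior].
    move=> [y [delta x]] /= [Ay [_ Bx]] [Yy _]; left => /=.
    apply: (clarke_dir_le (lipschitz_with_slicel L0 Lg y)).
    exists (B, T) => //= p Bp; exact: (AQ (y, p) (conj Ay (BT p Bp))).
  (* At a point that is not a minimizer, half of its excess over the minimum survives at nearby [y]
     by the Lipschitz bound. *)
  pose eta := (g (row_mx xbar ybar) - v xbar) / 2.
  have eta0 : 0 < eta by rewrite divr_gt0// subr_gt0.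
  exists ([set y | `|ybar - y| < eta / L], [set delta | delta < eta] `*` setT) => /=.
    split; first exact: (near_norm_lt ybar (divr_gt0 eta0 L0)).
    exists ([set delta | delta < eta], setT) => //=.
    by split; [exact: nbhs_right_lt|exact: filterT].
  move=> [y [delta x]] /= [yy [de _]] [Yy _]; right => /=.
  have := lipschitz_row_mx L0 Lg xbar xbar y ybar; rewrite subrr normr0 add0r.
  have : L * `|ybar - y| <= eta.
    by rewrite -ler_pdivlMl// mulrC ltW.
  have : v xbar + 2 * eta = g (row_mx xbar ybar) by rewrite /eta; field.
  lra.
move=> [D B] /= [nD nB] DB.
have : \forall delta \near 0^'+, D delta /\ 0 < delta < 1.
  apply: filterI => //; near=> delta; apply/andP; split; near: delta.
    exact: nbhs_right_gt.
  exact: nbhs_right_lt.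
move=> /(@filter_ex _ _ (at_right_proper_filter (0 : R)))[delta [Dd /andP[d0 d1]]].
exists delta => //; apply: filterS nB => x Bx y Yy.
(* Outside the compact sublevel set the excess is more than 1, hence more than [delta]. *)
have [gy|gy] := leP (g (row_mx xbar y)) (v xbar + 1).
  exact: (DB (delta, x) (conj Dd Bx) y (conj Yy gy)).
by right; rewrite (le_trans _ (ltW gy))// lerD2l ltW.
Unshelve. all: by end_near. Qed.

Lemma alphaE mu x y : 0 < mu -> OX x ->
  alpha g_ Y_ mu x y = expR ((v_ mu x - g_ mu (row_mx x y)) / mu).
Proof.
move=> mu0 Ox.
have F0 : 0 < gibbs_mass g_ Y_ mu x.
  by apply: (gibbs_mass_gt0 oOX oOY mu0) => //;
    [exact: cK|exact: KOY|exact: K0|exact: dg].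
rewrite /alpha -{1}[gibbs_mass _ _ _ _]lnK ?posrE// -expRN -expRD; congr expR.
by rewrite /v_ent; field; rewrite gt_eqF.
Qed.

(** The integrand is at most [alpha * (c + 2 * e1)], plus a constant [M * kappa] that pays for the
    points far from the minimum. As [alpha] has integral 1, the first term contributes [c + 2 * e1];
    the second contributes at most [e1]. *)
Lemma grad_v_ent_le (d : 'rV[R]_n) (c : R) :
  (forall e : R, 0 < e -> forall ybar, argmin g Y xbar ybar ->
    \forall y \near ybar & p \near filter_prod (nbhs xbar) (0 : R)^'+,
      Y y -> quotient (slice y) d p.1 p.2 <= c + e) ->
  forall e : R, 0 < e -> \forall x \near xbar & mu \near 0^'+,
    dotv (grad (v_ mu) x) d <= c + e.
Proof.
move=> H e e0; pose e1 := e / 3; have e10 : 0 < e1 by rewrite divr_gt0.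
have [delta d0 gap] := argmin_gap (H _ e10).
(* Bounds by how much the pairing of the gradient with [d], always at most [L * |d| + e1], may
   exceed [c + 2 * e1]. *)
pose M := `|L * `|d| + e1 - (c + 2 * e1)|.
have Mge0 : 0 <= M by exact: normr_ge0.
have M0 : 0 < M + 1 by rewrite ltr_wpDl.
(* The gap is [8 * k]. Replacing [g] by [g_ mu] and [x] by [xbar] leaves the [6 * k] of [kappa];
   replacing [v_ mu x] by [v xbar] and absorbing the volume leave [4 * k]. *)
pose k := delta / 8; have k0 : 0 < k by rewrite divr_gt0.
have r0 : 0 < k / L by rewrite divr_gt0.
have C1 := near_approx xbar_OX k0.
have C2 := filter_prod1 (G := (0 : R)^'+) (near_norm_lt xbar r0).
have C3 := gradx_le_clarke d e10.
have C4 : \forall x \near xbar & mu \near 0^'+, `|v xbar - v_ mu x| < k.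
  by have /(@cvgrPdist_lt _ _ _ (filter_prod (nbhs xbar) 0^'+))/(_ _ k0) :=
    v_ent_cvg xbar_OX.
have C5 : \forall mu \near 0^'+, `|mu * ln (fine (vol (Y_ mu)))| < k.
  have /cvgrPdist_lt/(_ _ k0) := vol_small.
  by apply: filterS => mu; rewrite sub0r normrN.
have C6 : \forall mu \near 0^'+, 0 < mu < e1 * (4 * k) / (M + 1).
  near=> mu; apply/andP; split; near: mu; first exact: nbhs_right_gt.
  by apply: nbhs_right_lt; rewrite divr_gt0// !mulr_gt0.
move: C5 C6 => /(filter_prod2 (F := nbhs xbar)) C5 /(filter_prod2 (F := nbhs xbar)) C6.
move: gap => /(filter_prod1 (G := (0 : R)^'+)) gap.
have : filter_prod (nbhs xbar) 0^'+ [set p |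
  (((OX p.1 /\ forall y, Y y -> `|g_ p.2 (row_mx p.1 y) - g (row_mx p.1 y)| < k) /\
    `|xbar - p.1| < k / L) /\
   ((forall y, Y y -> dotv (gradx (g_ p.2) p.1 y) d <= clarke_dir (slice y) p.1 d +
     e1) /\
    `|v xbar - v_ p.2 p.1| < k)) /\
  ((`|p.2 * ln (fine (vol (Y_ p.2)))| < k /\ 0 < p.2 < e1 * (4 * k) / (M + 1)) /\
   forall y, Y y -> clarke_dir (slice y) p.1 d <= c + e1 \/
     v xbar + delta <= g (row_mx xbar y))].
  apply: filterI; first by apply: filterI;
    [exact: filterI C1 (C2 _)|exact: filterI C3 C4].
  by apply: filterI; [exact: filterI C5 C6|exact: gap].
apply: filterS => -[x mu] /= [[[[Ox h1] h2] [h3 h4]] [[h5 /andP[mu0 mue]] h6]].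
have mK := compact_measurable_rV (cK mu0).
have [If ->] := dotv_grad_v_ent oOX oOY mu0 (cK mu0) (KOY mu0) (K0 mu0) (dg mu0) d Ox.
have [Ia Ia1] := integral_alpha oOX oOY mu0 (cK mu0) (KOY mu0) (K0 mu0) (dg mu0) Ox.
pose kappa := expR ((v_ mu x - (v xbar + 6 * k)) / mu).
have pw y : Y_ mu y -> alpha g_ Y_ mu x y * dotv (gradx (g_ mu) x y) d <=
    alpha g_ Y_ mu x y * (c + 2 * e1) + M * kappa.
  move=> Ky; have Yy := KY mu0 Ky.
  have a0 : 0 <= alpha g_ Y_ mu x y by rewrite alphaE// expR_ge0.
  have Mk : 0 <= M * kappa by rewrite mulr_ge0// expR_ge0.
  have G1 := h3 y Yy.
  have [G2|G2] := h6 y Yy.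
    rewrite (@le_trans _ _ (alpha g_ Y_ mu x y * (c + 2 * e1)))// ?lerDl//.
    by rewrite ler_wpM2l//; lra.
  rewrite -lerBlDl -mulrBr.
  have ak : alpha g_ Y_ mu x y <= kappa.
    rewrite alphaE// ler_expR ler_pM2r ?invr_gt0// lerD2l lerN2.
    have := h1 y Yy; rewrite ltr_norml => /andP[a1 a2].
    have := lipschitz_row_mx L0 Lg x xbar y y; rewrite subrr normr0 addr0.
    have : L * `|xbar - x| <= k by rewrite -ler_pdivlMl// mulrC ltW.
    have : delta = 8 * k by rewrite /k; field.
    lra.
  have G3 : clarke_dir (slice y) x d <= L * `|d|.
    have Ly := lipschitz_with_slicel L0 Lg y.
    by have := clarke_dd_le_lipschitz Ly x d; rewrite -(clarke_dirE Ly) lee_fin.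
  apply: (@le_trans _ _ (alpha g_ Y_ mu x y * M)).
    by rewrite ler_wpM2l// (le_trans _ (ler_norm _))// lerD2r; lra.
  by rewrite mulrC ler_wpM2l.
have Ic : (lebesgue_rV R m).-integrable (Y_ mu) (EFin \o (fun=> M * kappa)).
  apply: (continuous_integrable_rV (U := setT)); [exact: openT| |exact: cK|] => //.
  by move=> y _; exact: cst_continuous.
have Iac : (lebesgue_rV R m).-integrable (Y_ mu) (EFin \o (fun y =>
  alpha g_ Y_ mu x y * (c + 2 * e1))).
  by apply: eq_integrable (integrableZr mK (c + 2 * e1) Ia).
have Isum : (lebesgue_rV R m).-integrable (Y_ mu)
    (EFin \o (fun y => alpha g_ Y_ mu x y * (c + 2 * e1) + M * kappa)).
  by apply: eq_integrable (integrableD mK Iac Ic).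
apply: (le_trans (le_Rintegral mK If Isum pw)).
rewrite RintegralD// RintegralZr// Ia1 mul1r Rintegral_cst//.
have vol0 : 0 < fine (vol (Y_ mu)).
  by rewrite fine_gt0// K0//=; exact: compact_finite_lebesgue_rV (cK mu0).
have -> : e = 3 * e1 by rewrite /e1; field.
suff : M * kappa * fine (vol (Y_ mu)) <= e1 by lra.
have kv : kappa * fine (vol (Y_ mu)) <= mu / (4 * k).
  rewrite -[X in kappa * X]lnK ?posrE// /kappa -expRD.
  apply: (@le_trans _ _ (expR (- (4 * k / mu)))).
    rewrite ler_expR -[leRHS]mulNr.
    move: h4 h5; rewrite !ltr_norml => /andP[a1 a2] /andP[a3 a4].
    have -> : ((v_ mu x - (v xbar + 6 * k)) / mu + ln (fine (vol (Y_ mu)))) =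
       (v_ mu x - (v xbar + 6 * k) + mu * ln (fine (vol (Y_ mu)))) / mu.
      by field; rewrite gt_eqF.
    by rewrite ler_pM2r ?invr_gt0//; lra.
  (* With [s = 4 * k / mu], the bound [expR s >= 1 + s] gives [expR (- s) <= 1 / s]. *)
  rewrite expRN -[leRHS]invrK lef_pV2 ?posrE ?expR_gt0 ?invr_gt0 ?divr_gt0 ?mulr_gt0//.
  by rewrite invf_div (le_trans _ (expR_ge1Dx _))// lerDr.
rewrite -mulrA; apply: (@le_trans _ _ (M * (mu / (4 * k)))); first by rewrite ler_wpM2l.
apply: (@le_trans _ _ ((M + 1) * (mu / (4 * k)))).
  by rewrite ler_wpM2r ?divr_ge0 ?mulr_ge0 ?ltW// ltrDl.
move: mue; rewrite ltr_pdivlMr// => /ltW mue.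
by rewrite mulrA ler_pdivrMr ?mulr_gt0// mulrC.
Unshelve. all: by end_near. Qed.

Lemma grad_v_ent_bounded (d : 'rV[R]_n) : \forall x \near xbar & mu \near 0^'+,
    dotv (grad (v_ mu) x) d <= L * `|d| + 1.
Proof.
apply: grad_v_ent_le => // e e0 ybar _.
exists (setT, [set p | 0 < p.2]) => /=.
  by split; [exact: filterT|exact: near_prod_right_gt0].
move=> [y p] /= [_ t0] _; apply: (le_trans (ler_norm _)).
apply: (le_trans (quotient_lipschitz (lipschitz_with_slicel L0 Lg y) _ _ t0)).
by rewrite lerDl ltW.
Qed.

Lemma limsup_grad_le (d : 'rV[R]_n) (c : R) xi :
  (forall e : R, 0 < e -> \forall x \near xbar & mu \near 0^'+,
    dotv (grad (v_ mu) x) d <= c + e) ->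
  limsup_grad v_ xbar xi -> dotv xi d <= c.
Proof.
move=> H [z_ [mu_ [zx mu_gt0 mu0 gxi]]]; apply/ler_addgt0Pr => e e0.
have e2 : 0 < e / 2 by rewrite divr_gt0.
have [[A B] /= [nA nB] AB] := H _ e2.
have C1 : \forall k \near \oo, A (z_ k) by exact: zx.
have C2 : \forall k \near \oo, B (mu_ k).
  have nB' : \forall r \near (0 : R), 0 < r -> B r by exact: nB.
  have : \forall k \near \oo, 0 < mu_ k -> B (mu_ k) by exact: (mu0 _ nB').
  by apply: filterS => k /(_ (mu_gt0 k)).
have C3 : \forall k \near \oo, `|dotv xi d - dotv (grad (v_ (mu_ k)) (z_ k)) d| < e / 2.
  have cd : {for xi, continuous (dotv d : 'rV[R]_n -> R^o)} by exact: dotv_continuous.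
  have := @continuous_cvg _ _ _ \oo _ _ (dotv d : 'rV[R]_n -> R^o) _ cd gxi.
  move=> /(_ eventually_filter)/cvgrPdist_lt/(_ _ e2); apply: filterS => k.
  by rewrite /= ![dotv d _]dotvC.
near \oo => k.
have /AB/= h1 : (A `*` B) (z_ k, mu_ k) by split=> /=; near: k.
have : `|dotv xi d - dotv (grad (v_ (mu_ k)) (z_ k)) d| < e / 2 by near: k.
rewrite ltr_norml => /andP[h2 h3]; lra.
Unshelve. all: by end_near. Qed.

(** Testing along plus and minus each basis vector bounds the gradients at [xbar] as [mu] decreases
    to 0. Compactness gives a cluster point, reached along the constant sequence [xbar] with
    [mu_ k < 1 / (k + 1)]. *)
Lemma limsup_grad_nonempty : limsup_grad v_ xbar !=set0.
Proof.
pose G mu := grad (v_ mu) xbar.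
have Gd d : \forall mu \near 0^'+, dotv (G mu) d <= L * `|d| + 1.
  have [[A B] /= [nA nB] AB] := grad_v_ent_bounded d.
  by apply: filterS nB => mu Bmu; exact: (AB (xbar, mu) (conj (nbhs_singleton nA) Bmu)).
pose e i : 'rV[R]_n := delta_mx 0 i.
have e1 i : `|e i| <= 1.
  by apply: rV_norm_le => // j; rewrite mxE eqxx/=; case: (_ == _);
    rewrite ?normr1 ?normr0.
have Gi : \forall mu \near 0^'+, forall i, `|G mu 0 i| <= L + 1.
  apply: filter_forall => i; near=> mu.
  have h1 : dotv (G mu) (e i) <= L * `|e i| + 1 by near: mu; exact: Gd.
  have h2 : dotv (G mu) (- e i) <= L * `|- e i| + 1 by near: mu; exact: Gd.
  have Le : L * `|e i| <= L by rewrite ler_piMr// ltW.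
  move: h1 h2; rewrite normrN dotvNr dotv_delta => h1 h2.
  by rewrite ler_norml; apply/andP; split; lra.
pose K : set 'rV[R]_n := [set u | `|u| <= L + 1].
have cptK : compact K.
  apply: bounded_closed_compact.
    exists (L + 1); split; first exact: num_real.
    by move=> c Lc u /= /le_trans; apply; exact: ltW.
  have := @preimage_closed _ _ (fun u : 'rV[R]_n => `|u|) [set r | r <= L + 1].
  by apply => [u _|]; [exact: norm_continuous|exact: closed_le].
have [|xi [_ xic]] := cptK (G mu @[mu --> 0^'+]) _.
  by apply: filterS Gi => mu H; apply: rV_norm_le => //; rewrite addr_ge0// ltW.
have step (k : nat) : {mu : R | 0 < mu < k.+1%:R^-1 & `|xi - G mu| < k.+1%:R^-1}.
  have k0 : 0 < k.+1%:R^-1 :> R by rewrite invr_gt0.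
  apply: cid2.
  have F1 : \forall mu \near (0 : R)^'+, 0 < mu < k.+1%:R^-1.
    near=> mu; apply/andP; split; near: mu; [exact: nbhs_right_gt|exact: nbhs_right_lt].
  have F2 : nbhs (G mu @[mu --> 0^'+]) (G @` [set mu | 0 < mu < k.+1%:R^-1]).
    by apply: filterS F1 => mu H; exists mu.
  have [_ [[mu H <-] /= xiG]] := xic _ _ F2 (near_norm_lt xi k0).
  by exists mu.
pose mu_ k := s2val (step k).
have inv0 : (k.+1%:R^-1 : R) @[k --> \oo] --> (0 : R) by exact: cvg_harmonic.
exists xi, (fun=> xbar), mu_; split.
- exact: cvg_cst.
- by move=> k; have /andP[] := s2valP (step k).
- apply/cvgrPdist_lt => r r0; have /cvgrPdist_lt/(_ _ r0) := inv0.
  apply: filterS => k; rewrite !sub0r !normrN; apply: le_lt_trans.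
  have /andP[h1 h2] := s2valP (step k).
  by rewrite !gtr0_norm// ?invr_gt0// ltW.
- apply/cvgrPdist_lt => r r0; have /cvgrPdist_lt/(_ _ r0) := inv0.
  apply: filterS => k; rewrite sub0r normrN gtr0_norm ?invr_gt0//.
  by apply: lt_trans; exact: (s2valP' (step k)).
Unshelve. all: by end_near. Qed.

(** * Criterion for gradient consistency and its three cases *)

Lemma gradient_consistent_criterion :
  (forall d (c : R), clarke_dir v xbar d < c -> forall e : R, 0 < e ->
    forall ybar, argmin g Y xbar ybar ->
    \forall y \near ybar & p \near filter_prod (nbhs xbar) (0 : R)^'+,
      Y y -> quotient (slice y) d p.1 p.2 <= c + e) ->
  gradient_consistent v_ v xbar.
Proof.
move=> H; split; first exact: limsup_grad_nonempty.
move=> xi xil; apply/(clarkeP (value_lipschitz L0 Lg Y0 lbg)) => d.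
(* The slack [e] makes [c = clarke_dir v xbar d + e] strictly larger than the Clarke derivative. *)
apply/ler_addgt0Pr => e e0; apply: limsup_grad_le xil; apply: grad_v_ent_le.
by apply: H; rewrite ltrDl.
Qed.

(** A backward quotient at [xbar] is a forward one based at [xbar - s *: d]; the Clarke derivative
    controls it because its base point is allowed to move. *)
Lemma backward_quotient_le ybar (d : 'rV[R]_n) (c : R) :
  argmin g Y xbar ybar -> clarke_dir v xbar d < c ->
  \forall s \near 0^'+, quotient (slice ybar) d (xbar - s *: d) s < c.
Proof.
move=> /(argminP L0 Lg Y0 lbg)[Yy gy].
move=> /(clarke_dir_lt (value_lipschitz L0 Lg Y0 lbg)) [[A B] /= [nA nB] AB].
have C1 : \forall s \near (0 : R)^'+, A (xbar - s *: d).
  suff : xbar - s *: d @[s --> (0 : R)^'+] --> xbar by apply.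
  rewrite -[X in _ --> X]subr0 -(scale0r d).
  apply: cvgB; first exact: cvg_cst.
  by apply: cvgZr_tmp; exact: cvg_within.
near=> s; have s0 : 0 < s by near: s; exact: nbhs_right_gt.
have : quotient v d (xbar - s *: d) s < c.
  by apply: (AB (xbar - s *: d, s)); split=> /=; near: s.
apply: le_lt_trans; rewrite /quotient subrK ler_pM2r ?invr_gt0//.
by rewrite lerB//; exact: (value_le L0 Lg Y0 lbg).
Unshelve. all: by end_near. Qed.

(** With the step [s] frozen, the quotient depends continuously on the base point and on [y], so a
    bound at [(xbar, ybar)] spreads to a neighborhood. *)
Lemma quotient_slice_near ybar (d w : 'rV[R]_n) (s e : R) : 0 < s -> 0 < e ->
  \forall y \near ybar & p \near filter_prod (nbhs xbar) (0 : R)^'+,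
    quotient (slice y) d (p.1 + w) s <= quotient (slice ybar) d (xbar + w) s + e.
Proof.
(* The quotient has two values of [g], each moved by at most [2 * r]: the total [4 * L * r] is
   [e * s]. *)
move=> s0 e0; pose r := e * s / 4 / L.
have r0 : 0 < r by rewrite !(divr_gt0, mulr_gt0).
exists ([set y | `|ybar - y| < r], [set p | `|xbar - p.1| < r]) => /=.
  split; first exact: (near_norm_lt ybar r0).
  exists ([set x | `|xbar - x| < r], setT) => /=; last by move=> p [].
  by split; [exact: (near_norm_lt xbar r0)|exact: filterT].
move=> [y [z t]] /= [yr zr].
have Lr : L * r = e * s / 4 by rewrite /r; field; rewrite gt_eqF.
have LL a b : `|a - b| = `|xbar - z| -> L * (`|a - b| + `|y - ybar|) <= e * s / 2.
  move=> ->; apply: (@le_trans _ _ (L * (r + r))).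
    by rewrite ler_pM2l// lerD// ltW// distrC.
  by rewrite mulrDr Lr; lra.
rewrite /quotient -lerBlDl -mulrBl ler_pdivrMr//.
have h1 := lipschitz_row_mx L0 Lg (xbar + w + s *: d) (z + w + s *: d) ybar y.
have h2 := lipschitz_row_mx L0 Lg (z + w) (xbar + w) y ybar.
have k1 : L * (`|z + w + s *: d - (xbar + w + s *: d)| + `|y - ybar|) <= e * s / 2.
  apply: LL; rewrite distrC; congr `|_|; apply/rowP => i; rewrite !mxE; ring.
have k2 : L * (`|xbar + w - (z + w)| + `|ybar - y|) <= e * s / 2.
  by rewrite [`|ybar - y|]distrC; apply: LL; congr `|_|; apply/rowP => i;
    rewrite !mxE; ring.
by rewrite /slice; lra.
Qed.

Lemma gradient_consistent_smooth Omega : nbhs xbar Omega ->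
  (forall x y, Omega x -> OY y -> differentiable (fun x' => g (row_mx x' y)) x) ->
  {within setX_rV Omega OY, continuous (fun z => gradx g (lsubmx z) (rsubmx z))} ->
  gradient_consistent v_ v xbar.
Proof.
move=> nO dgx cgx; apply: gradient_consistent_criterion => d c vc e e0 ybar ay.
have Yy := ay.1.
have e2 : 0 < e / 2 by rewrite divr_gt0.
pose psi z : R^o := dotv d (gradx g (lsubmx z) (rsubmx z)).
have nZ : \forall z \near row_mx xbar ybar, setX_rV Omega OY z.
  have : nbhs (row_mx xbar ybar) (setX_rV (interior Omega) OY).
    apply: open_nbhs_nbhs; split; first exact: open_setX_rV (@open_interior _ _) oOY.
    by apply: setX_rV_row_mx; [exact: nO|exact: YOY].
  by apply: filterS => z [Oz Yz]; split=> //; exact: interior_subset.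
have cpsi : {for row_mx xbar ybar, continuous psi}.
  have cg0 : {for row_mx xbar ybar, continuous (fun z =>
    gradx g (lsubmx z) (rsubmx z))}.
    have := cgx (row_mx xbar ybar); rewrite /continuous_at -nbhs_subspace_interior//.
  exact: (@continuous_cvg _ _ _ (nbhs (row_mx xbar ybar)) _ _ (dotv d : 'rV[R]_n ->
    R^o) _
    (@dotv_continuous _ _ d _) cg0).
have nC : \forall z \near row_mx xbar ybar, setX_rV Omega OY z /\
    `|psi (row_mx xbar ybar) - psi z| < e / 2.
  by apply: filterI => //; move/(@cvgrPdist_lt _ _ _ (nbhs (row_mx xbar ybar))) :
    cpsi; exact.
have [r /= r0 Hr] : exists2 r : R, 0 < r & forall x y, `|xbar - x| < r ->
  `|ybar - y| < r ->
    [/\ Omega x, OY y & `|psi (row_mx xbar ybar) - psi (row_mx x y)| < e / 2].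
  have /nbhs_normP[r /= r0 Hr] := nC; exists (r / 2); first by rewrite divr_gt0.
  move=> x y xr yr; have [|[Ox Oy] H] := Hr (row_mx x y).
    rewrite /= opp_row_mx add_row_mx (le_lt_trans (norm_row_mx _ _))//.
    by rewrite [r]splitr ltrD.
  by move: Ox Oy; rewrite row_mxKl row_mxKr.
(* The radius is shared equally between the base point and the displacement, so the whole segment
   stays where [psi] varies by less than [e / 2]. *)
have mvt x y t : 0 < t -> `|xbar - x| < r / 2 -> t * `|d| < r / 2 -> `|ybar - y| < r ->
    `|psi (row_mx xbar ybar) - quotient (slice y) d x t| < e / 2.
  move=> t0 xr tr yr.
  have seg (a : R) : 0 <= a <= 1 -> `|xbar - (x + a *: (t *: d))| < r.
    move=> /andP[a0 a1]; rewrite opprD addrA (le_lt_trans (ler_normB _ _))//.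
    rewrite [r]splitr ltrD// !normrZ ger0_norm// (gtr0_norm t0) (le_lt_trans _ tr)//.
    by rewrite ler_piMl// mulr_ge0// ltW.
  have [a a01|a a01 E] := @gradient_MVT _ _ (slice y) x (t *: d).
    by have [Ox Oy _] := Hr _ _ (seg a a01) yr; exact: dgx.
  rewrite /quotient E dotvZr mulrAC mulfV ?gt_eqF// mul1r.
  have [_ _] := Hr _ _ (seg a a01) yr.
  by rewrite {2}/psi row_mxKl row_mxKr [X in _ - X]dotvC.
(* The backward quotient, which is below [c], is one of the quotients that [mvt] compares with [psi]
   at [(xbar, ybar)]. *)
have Gc : psi (row_mx xbar ybar) <= c + e / 2.
  near (0 : R)^'+ => s.
  have s0 : 0 < s by near: s; exact: nbhs_right_gt.
  have sc : s < (r / 2) / (`|d| + 1).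
    by near: s; apply: nbhs_right_lt; rewrite !divr_gt0// ltr_wpDl.
  have sd : s * `|d| < r / 2.
    move: sc; rewrite ltr_pdivlMr ?ltr_wpDl//; apply: le_lt_trans.
    by rewrite ler_pM2l// lerDl.
  have h1 : quotient (slice ybar) d (xbar - s *: d) s < c.
    by near: s; exact: backward_quotient_le.
  have := mvt (xbar - s *: d) ybar s s0.
  rewrite opprB addrCA subrr addr0 normrZ (gtr0_norm s0) subrr normr0.
  by move=> /(_ sd sd r0); rewrite ltr_norml => /andP[h2 h3]; lra.
exists ([set y | `|ybar - y| < r], [set p | `|xbar - p.1| < r / 2 /\ (0 < p.2 /\
  p.2 * `|d| < r / 2)]) => /=.
  split; first exact: (near_norm_lt ybar r0).
  exists ([set x | `|xbar - x| < r / 2], [set t | 0 < t /\ t * `|d| < r / 2]) => /=;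
    last by move=> p [].
  split; first by apply: (near_norm_lt xbar); rewrite divr_gt0.
  near=> t; have t0 : 0 < t by near: t; exact: nbhs_right_gt.
  split=> //; have sc : t < (r / 2) / (`|d| + 1).
    by near: t; apply: nbhs_right_lt; rewrite !divr_gt0// ltr_wpDl.
  move: sc; rewrite ltr_pdivlMr ?ltr_wpDl//; apply: le_lt_trans.
  by rewrite ler_pM2l// lerDl.
move=> [y [x t]] /= [yr [xr [t0 tr]]] _.
have := mvt x y t t0 xr tr yr.
by rewrite ltr_norml => /andP[h2 h3]; lra.
Unshelve. all: by end_near. Qed.

Lemma gradient_consistent_weakly_concave Omega (rho : R) : nbhs xbar Omega -> 0 < rho ->
  (forall y, Y y -> weakly_concave rho Omega (fun x => g (row_mx x y))) ->
  gradient_consistent v_ v xbar.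
Proof.
move=> nO rho0 wc; apply: gradient_consistent_criterion => d c vc e e0 ybar ay.
have /nbhs_normP[r /= r0 Hr] := nO.
have e2 : 0 < e / 2 by rewrite divr_gt0.
pose D := dotv d d.
have D0 : 0 <= D by rewrite /D -enorm_sqr sqr_ge0.
have rD0 : 0 <= rho * D by rewrite mulr_ge0// ltW.
have rD1 : 0 < rho * D + 1 by rewrite ltr_wpDl.
have erD : 0 < (e / 2) / (rho * D + 1) by rewrite divr_gt0.
near (0 : R)^'+ => s.
have s0 : 0 < s by near: s; exact: nbhs_right_gt.
have sc : s < (r / 2) / (`|d| + 1).
  by near: s; apply: nbhs_right_lt; rewrite !divr_gt0// ltr_wpDl.
have sd : s * `|d| < r / 2.
  move: sc; rewrite ltr_pdivlMr ?ltr_wpDl//; apply: le_lt_trans.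
  by rewrite ler_pM2l// lerDl.
have srho : s < (e / 2) / (rho * D + 1).
  by near: s; exact: nbhs_right_lt.
(* The step [s] is fixed before [t]: for [t < s] the weak concavity error, [rho / 2 * (s + t) * D],
   is at most [s * (rho * D)]. *)
have srD : s * (rho * D) <= e / 2.
  move: srho; rewrite ltr_pdivlMr ?ltr_wpDl// => /ltW; apply: le_trans.
  by rewrite ler_pM2l// lerDl.
have h1 : quotient (slice ybar) d (xbar - s *: d) s < c.
  by near: s; exact: backward_quotient_le.
have N1 := quotient_slice_near ybar d (- (s *: d)) s0 e2.
have N2 : \forall y \near ybar & p \near filter_prod (nbhs xbar) (0 : R)^'+,
    [/\ `|xbar - p.1| < r / 2, 0 < p.2 & p.2 < s].
  exists (setT, [set p | [/\ `|xbar - p.1| < r / 2, 0 < p.2 & p.2 < s]]) => /=;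
    last by move=> p [].
  split; first exact: filterT.
  exists ([set x | `|xbar - x| < r / 2], [set t | 0 < t /\ t < s]) => /=;
    last by move=> p [? []].
  split; first by apply: (near_norm_lt xbar); rewrite divr_gt0.
  by apply: filterI; [exact: nbhs_right_gt|exact: nbhs_right_lt].
have : filter_prod (nbhs ybar) (filter_prod (nbhs xbar) (0 : R)^'+) [set q |
    quotient (slice q.1) d (q.2.1 - s *: d) s <=
      quotient (slice ybar) d (xbar - s *: d) s + e / 2 /\
    [/\ `|xbar - q.2.1| < r / 2, 0 < q.2.2 & q.2.2 < s]] by exact: filterI N1 N2.
apply: filterS => -[y [z t]] /= [h2 [zr t0 ts]] Yy.
have Ot : Omega (z + t *: d).
  apply: Hr => /=; rewrite opprD addrA (le_lt_trans (ler_normB _ _))// [r]splitr ltrD//.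
  rewrite normrZ (gtr0_norm t0) (le_lt_trans _ sd)// ler_wpM2r//; exact: ltW.
have Os : Omega (z - s *: d).
  apply: Hr => /=; rewrite opprD addrA (le_lt_trans (ler_normB _ _))// [r]splitr ltrD//.
  by rewrite normrN normrZ (gtr0_norm s0).
apply: (le_trans (weakly_concave_quotient (wc y Yy) Ot Os s0 t0)).
have : rho / 2 * (s + t) * D <= s * (rho * D).
  rewrite (_ : rho / 2 * (s + t) * D = (s + t) / 2 * (rho * D)); last by field.
  by rewrite ler_wpM2r//; lra.
by rewrite -/D; rewrite /= in h2; lra.
Unshelve. all: by end_near. Qed.

(* Sandwich between the Clarke derivative and 0 on the cone generated by Y - ybar. *)
Lemma convex_normal_subgradient ybar : argmin g Y xbar ybar ->
  exists2 eta, clarkey g xbar ybar eta & forall y, Y y -> 0 <= dotv eta (y - ybar).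
Proof.
move=> [Yb Hb]; have Lx := lipschitz_with_slicer L0 Lg xbar.
(* Second component 0: the demand is nonnegativity on the cone generated by [Y - ybar]. *)
pose C : set ('rV[R]_m * R) := [set c | c.2 = 0 /\ exists (a : R) y, [/\ 0 <= a,
  Y y & c.1 = a *: (y - ybar)]].
have [||eta H1 H2] := @sublinear_sandwich _ _ _ C (clarke_dir_sublinear Lx ybar).
- split.
  + by split=> //; exists 0, ybar; split=> //; rewrite scale0r.
  + move=> [_ _] [_ _] [/= -> [a [y [a0 Yy ->]]]] [/= -> [b [y' [b0 Yy' ->]]]].
    split; first exact: addr0.
    (* A sum of two generators is renormalized to a convex combination of [y] and [y'], which
       requires a nonzero total weight. *)
    have [ab|ab] := eqVneq (a + b) 0.
      have a00 : a = 0 by lra. have b00 : b = 0 by lra.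
      by exists 0, ybar; split=> //; rewrite a00 b00 !scale0r addr0.
    have ab0 : 0 < a + b by rewrite lt_neqAle eq_sym ab addr_ge0.
    exists (a + b), ((a / (a + b)) *: y + (1 - a / (a + b)) *: y'); split;
      first exact: ltW.
      apply: convex_setE => //; first by rewrite divr_ge0// ltW.
      by rewrite ler_pdivrMr// mul1r lerDl.
    by apply/rowP => i; rewrite !mxE; field.
  + move=> a [_ _] a0 [/= -> [b [y [b0 Yy ->]]]]; split; first exact: mulr0.
    by exists (a * b), y; split=> //; rewrite ?scalerA// mulr_ge0.
- move=> [_ _] [/= -> [a [y [a0 Yy ->]]]].
  (* For [t < 1] the point [ybar + t *: (y - ybar)] lies in [Y], so minimality of [ybar] makes the
     quotient nonnegative. *)
  rewrite (clarke_dir_sublinear Lx ybar).2// mulr_ge0//.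
  apply: (clarke_dir_ge Lx); near=> t.
  have t0 : 0 < t by near: t; exact: nbhs_right_gt.
  have t1 : t < 1 by near: t; exact: nbhs_right_lt.
  rewrite /quotient; apply: divr_ge0; last exact: ltW.
  rewrite subr_ge0; apply: Hb.
  rewrite (_ : ybar + _ = t *: y + (1 - t) *: ybar); last by apply/rowP => i;
    rewrite !mxE; ring.
  by apply: convex_setE => //; exact: ltW.
exists eta; first exact/(clarkeP Lx).
move=> y Yy; apply: (H2 (y - ybar, 0)); split=> //.
by exists 1, y; split=> //; rewrite scale1r.
Unshelve. all: by end_near. Qed.

Lemma gradient_consistent_convex :
  (forall ybar, argmin g Y xbar ybar ->
     clarke g (row_mx xbar ybar) =
     setX_rV (clarkex g xbar ybar) (clarkey g xbar ybar)) ->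
  convex_function (setT : set (convex_lmodType 'rV[R]_(n + m))) g ->
  gradient_consistent v_ v xbar.
Proof.
move=> prodc cg; apply: gradient_consistent_criterion => d c vc e e0 ybar ay.
have Ly := lipschitz_with_slicel L0 Lg ybar.
have Lv := value_lipschitz L0 Lg Y0 lbg.
have [xi xic xid] := sublinear_support d (clarke_dir_sublinear Ly xbar).
have [eta etac etaY] := convex_normal_subgradient ay.
have /(clarkeP Lg) sub : clarke g (row_mx xbar ybar) (row_mx xi eta).
  by rewrite prodc//; apply: setX_rV_row_mx => //; exact/(clarkeP Ly).
have vsub x : v xbar + dotv xi (x - xbar) <= v x.
  apply: (value_ge L0 Lg Y0 lbg) => y Yy.
  have := le_trans (sub (row_mx (x - xbar) (y - ybar)))
    (convex_clarke_dir_le (row_mx xbar ybar) (row_mx (x - xbar) (y - ybar)) L0 Lg cg).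
  rewrite dotv_row_mx row_mxKl row_mxKr add_row_mx ![_ + (_ - _)]addrC !subrK.
  have := etaY y Yy; have := value_le L0 Lg Y0 lbg xbar ay.1; lra.
(* The subgradient [xi] of [v] bounds the Clarke derivative of [v] from below by [dotv xi d], which
   is the partial Clarke derivative by the choice of [xi]. *)
have pc : clarke_dir (slice ybar) xbar d < c.
  apply: le_lt_trans vc; rewrite -xid; apply: (clarke_dir_ge Lv); near=> t.
  have t0 : 0 < t by near: t; exact: nbhs_right_gt.
  rewrite /quotient ler_pdivlMr//; have := vsub (xbar + t *: d).
  by rewrite [xbar + _]addrC addrK dotvZr; lra.
have : \forall s \near 0^'+, quotient (slice ybar) d xbar s < c.
  have [[A B] /= [nA nB] AB] := clarke_dir_lt Ly pc.
  by apply: filterS nB => s Bs; exact: (AB (xbar, s) (conj (nbhs_singleton nA) Bs)).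
(* One step [s] with quotient below [c] is enough: the bound spreads to nearby [(z, y)] at this
   step, and convexity passes it to all smaller steps. *)
move=> sc; near (0 : R)^'+ => s.
have s0 : 0 < s by near: s; exact: nbhs_right_gt.
have sc' : quotient (slice ybar) d xbar s < c by near: s; exact: sc.
have N1 := quotient_slice_near ybar d 0 s0 e0.
have N2 : \forall y \near ybar & p \near filter_prod (nbhs xbar) (0 : R)^'+,
    0 < p.2 /\ p.2 < s.
  exists (setT, [set p | 0 < p.2 /\ p.2 < s]) => /=; last by move=> p [].
  split; first exact: filterT.
  exists (setT, [set t | 0 < t /\ t < s]) => /=; last by move=> p [? []].
  split; first exact: filterT.
  by apply: filterI; [exact: nbhs_right_gt|exact: nbhs_right_lt].
have : filter_prod (nbhs ybar) (filter_prod (nbhs xbar) (0 : R)^'+) [set q |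
    quotient (slice q.1) d (q.2.1 + 0) s <= quotient (slice ybar) d (xbar + 0) s + e /\
    0 < q.2.2 /\ q.2.2 < s] by exact: filterI N1 N2.
apply: filterS => -[y [z t]] /= [+ [t0 ts]] Yy; rewrite !addr0 => h2.
have cy : convex_function (setT : set (convex_lmodType 'rV[R]_n)) (slice y).
  move=> a x x' _ _.
  have := cg a (row_mx x y) (row_mx x' y) (mem_setT _) (mem_setT _).
  apply: le_trans; rewrite le_eqVlt; apply/orP; left; apply/eqP; congr g.
  rewrite [RHS](_ : _ = a%:num *: row_mx x y + (1 - a%:num) *: row_mx x' y)//.
  by rewrite !scale_row_mx add_row_mx -scalerDl [a%:num + _]addrC subrK scale1r.
apply: (le_trans (convex_quotient_le z d cy t0 (ltW ts))); lra.
Unshelve. all: by end_near. Qed.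

End entropic_limit.
(** A strictly positive constant is extracted because radii such as [e / L] are used throughout. *)
Lemma lipschitz_witness (R : realType) d (f : 'rV[R]_d -> R) :
  lipschitz f -> exists2 L : R, 0 < L & lipschitz_with L f.
Proof.
move=> Lf; near (pinfty_nbhs R) => L; exists L; first by near: L; exact: nbhs_pinfty_gt.
have H : L.-lipschitz f by near: L.
by move=> u w; exact: (H (u, w)).
Unshelve. all: by end_near. Qed.

Theorem theorem4p24 (R : realType) (n m : nat)
  (X OX : set 'rV[R]_n) (Y OY : set 'rV[R]_m)
  (g : 'rV[R]_(n + m) -> R) (g_ : R -> 'rV[R]_(n + m) -> R)
  (Y_ : R -> set 'rV[R]_m) (xbar : 'rV[R]_n) (Omega : set 'rV[R]_n)
  (X_neq0 : X !=set0) (X_closed : closed X)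
  (X_convex : convex_set (X : set (convex_lmodType 'rV[R]_n)))
  (Y_closed : closed Y)
  (Y_convex : convex_set (Y : set (convex_lmodType 'rV[R]_m)))
  (Y_unbounded : ~ bounded_set Y)
  (OX_open : open OX) (X_OX : X `<=` OX)
  (OY_open : open OY) (Y_OY : Y `<=` OY)
  (g_lipschitz : lipschitz g)
  (g_smooth_approx : smooth_approximations g_ g (setX_rV OX OY))
  (Y_compact : forall mu, 0 < mu -> compact (Y_ mu))
  (Y_sub : forall mu, 0 < mu -> Y_ mu `<=` Y)
  (Y_vol : forall mu, 0 < mu -> (0 < vol (Y_ mu))%E)
  (Y_increases : increases_to Y_ Y)
  (xbar_OX : OX xbar)
  (h1 : level_bounded g)
  (h2 : forall Omega' : set 'rV[R]_n, open Omega' -> closure Omega' `<=` OX ->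
    forall e : R, 0 < e -> \forall mu \near 0^'+,
      forall x y, closure Omega' x -> Y y ->
        `|g_ mu (row_mx x y) - g (row_mx x y)| < e)
  (h3 : forall e : R, 0 < e -> \forall x \near xbar & mu \near 0^'+,
      forall y, Y y -> dist (gradx (g_ mu) x y) (clarkex g x y) < e)
  (h4 : mu * ln (fine (vol (Y_ mu))) @[mu --> 0^'+] --> (0 : R))
  (h5 : forall Z : set 'rV[R]_m, closed Z -> Z `<=` Y `\` argmin g Y xbar ->
    exists2 h : 'rV[R]_m -> R,
      (lebesgue_rV R m).-integrable Z (EFin \o h) &
      \forall x \near xbar & mu \near 0^'+,
        forall y, Z y -> alpha g_ Y_ mu x y <= h y)
  (h6 : forall Z : set 'rV[R]_m, closed Z -> Z `<=` Y `\` argmin g Y xbar ->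
    exists2 H : 'rV[R]_m -> R,
      (lebesgue_rV R m).-integrable Z (EFin \o H) &
      \forall x \near xbar & mu \near 0^'+,
        forall y, Z y ->
          alpha g_ Y_ mu x y * enorm (gradx (g_ mu) x y) <= H y)
  (Omega_nbhs : nbhs xbar Omega)
  (habc :
    [\/ (forall x y, Omega x -> OY y ->
           differentiable (fun x' => g (row_mx x' y)) x) /\
        {within setX_rV Omega OY,
          continuous (fun z => gradx g (lsubmx z) (rsubmx z))},
        exists2 rho : R, 0 < rho &
          forall y, Y y -> weakly_concave rho Omega (fun x => g (row_mx x y))
      | (forall ybar, argmin g Y xbar ybar ->
           clarke g (row_mx xbar ybar) =
           setX_rV (clarkex g xbar ybar) (clarkey g xbar ybar)) /\
        convex_function (setT : set (convex_lmodType 'rV[R]_(n + m))) g]) :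
  smooth_approximations (v_ent g_ Y_) (value g Y) OX /\
  gradient_consistent (v_ent g_ Y_) (value g Y) xbar.
Proof.
have [L L0 Lg] := lipschitz_witness g_lipschitz.
(* The empty set is bounded. *)
have Y0 : Y !=set0.
  apply: contrapT => /set0P/negP; rewrite negbK => /eqP Y0; apply: Y_unbounded.
  by rewrite Y0; exists 0; split=> // ? ? ?.
have dg mu : 0 < mu -> continuously_differentiable (setX_rV OX OY) (g_ mu).
  by case: g_smooth_approx => _ _ + _; exact.
split.
  exact: (v_ent_smooth_approximations OX_open OY_open Y_OY L0 Lg h1 Y0 Y_closed
    Y_convex dg Y_compact Y_sub Y_vol Y_increases h2 h4).
case: habc => [[dgx cgx]|[rho rho0 wc]|[prodc cg]].
- exact: (gradient_consistent_smooth OX_open OY_open Y_OY L0 Lg h1 Y0 Y_closed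
    Y_convex dg Y_compact Y_sub Y_vol Y_increases h2 h4 xbar_OX h3 Omega_nbhs dgx cgx).
- exact: (gradient_consistent_weakly_concave OX_open OY_open Y_OY L0 Lg h1 Y0 Y_closed
    Y_convex dg Y_compact Y_sub Y_vol Y_increases h2 h4 xbar_OX h3 Omega_nbhs rho0 wc).
- exact: (gradient_consistent_convex OX_open OY_open Y_OY L0 Lg h1 Y0 Y_closed
    Y_convex dg Y_compact Y_sub Y_vol Y_increases h2 h4 xbar_OX h3 prodc cg).
Qed.
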